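(* Assuming ETH, for any constant $r>0$ and any $\varepsilon>0$, there is no $r$-approximation algorithm for \textsc{$k$-Upper Dominating Set} running in time $O(n^{k^{1-\varepsilon}})$, where $n$ is the number of vertices of the input graph.
   Context: Let $G=(V,E)$ be a graph. A set $D\subseteq V$ is dominating if every vertex of $V$ is in $D$ or adjacent to a vertex of $D$. An upper dominating set is an inclusion-minimal dominating set. \textsc{$k$-Upper Dominating Set}: given $G$ and an integer $k$, decide whether $G$ has an upper dominating set of size at least $k$. An $r$-approximation algorithm for this parameterized problem is an algorithm which, on an instance $(G,k)$ where $G$ has an upper dominating set of size at least $k$, outputs an upper dominating set whose size is within a factor $r$ of $k$ (i.e. at least $\min(r,1/r)\cdot k$). ETH: there is $\delta>0$ such that 3-SAT on $n$ variables cannot be solved in time $2^{\delta n}$. *)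

(* Defs.v *)
From HB Require Import structures.
From mathcomp Require Import all_boot all_order all_algebra.
From mathcomp Require Import reals exp.

Set Implicit Arguments.
Unset Strict Implicit.
Unset Printing Implicit Defensive.

Import Order.TTheory GRing.Theory Num.Theory.

(* Deterministic multi-tape machines over {0, 1, blank}; tape 0 holds the
   input. *)
Definition symbol := option bool.

Inductive direction := MoveLeft | Stay | MoveRight.

(* Two-way infinite tape: cells left of the head (nearest first), scanned cell,
   cells right of the head; all unlisted cells are blank. *)
Definition tape : Type := seq symbol * symbol * seq symbol.

Definition scanned (t : tape) : symbol := t.1.2.

Definition write_move (am : symbol * direction) (t : tape) : tape :=
  let: (l, _, r) := t in
  let: (a, d) := am in
  match d with
  | MoveLeft => (behead l, head None l, a :: r)
  | Stay => (l, a, r)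
  | MoveRight => (a :: l, head None r, behead r)
  end.

Record machine := Machine {
  extra_tapes : nat;
  state : finType;
  start : state;
  halting : pred state;
  trans : state -> {ffun 'I_extra_tapes.+1 -> symbol} ->
          state * ('I_extra_tapes.+1 -> symbol * direction)
}.

Record config (M : machine) := Config {
  cstate : state M;
  ctapes : 'I_(extra_tapes M).+1 -> tape
}.

Definition blank_tape : tape := ([::], None, [::]).

Definition word_tape (x : seq bool) : tape :=
  let s := map some x in ([::], head None s, behead s).

Definition init_config (M : machine) (x : seq bool) : config M :=
  Config (start M) (fun i => if i == ord0 then word_tape x else blank_tape).

Definition step (M : machine) (c : config M) : config M :=
  if halting (cstate c) then c else
  let: (q, am) := trans (cstate c) [ffun i => scanned (ctapes c i)] in
  Config q (fun i => write_move (am i) (ctapes c i)).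

Definition run (M : machine) (x : seq bool) (t : nat) : config M :=
  iter t (@step M) (init_config M x).

Definition halts_within (M : machine) (x : seq bool) (t : nat) : Prop :=
  halting (cstate (run M x t)).

Fixpoint read_bits (s : seq symbol) : seq bool :=
  if s is Some b :: s' then b :: read_bits s' else [::].

(* The result is the word on tape 0 from the head rightwards to the first
   blank. *)
Definition result (M : machine) (c : config M) : seq bool :=
  let: (_, a, r) := ctapes c ord0 in read_bits (a :: r).

(* [step] is the identity on halted configurations, so [y] does not depend on
   the choice of [t]. *)
Definition outputs (M : machine) (x y : seq bool) : Prop :=
  exists2 t, halts_within M x t & result (run M x t) = y.

Definition unary (m : nat) : seq bool := rcons (nseq m true) false.

Definition literal (n : nat) : Type := ('I_n * bool)%type.
Definition clause (n : nat) : Type := 3.-tuple (literal n).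
Definition formula (n : nat) : Type := seq (clause n).

Definition satisfiable (n : nat) (phi : formula n) : bool :=
  [exists a : {ffun 'I_n -> bool},
    all (fun c : clause n => has (fun l : literal n => a l.1 == l.2) c) phi].

Definition encode_literal (n : nat) (l : literal n) : seq bool :=
  l.2 :: unary l.1.

Definition encode_clause (n : nat) (c : clause n) : seq bool :=
  flatten (map (@encode_literal n) c).

Definition encode_formula (n : nat) (phi : formula n) : seq bool :=
  unary n ++ flatten [seq true :: encode_clause c | c <- phi] ++ [:: false].

Definition solves_3sat (M : machine) : Prop :=
  forall (n : nat) (phi : formula n), uniq phi ->
    outputs M (encode_formula phi) [:: satisfiable phi].

Local Open Scope ring_scope.

Definition sat_time (R : realType) (M : machine) (delta : R) : Prop :=
  exists C : R, forall (n : nat) (phi : formula n), uniq phi ->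
    exists2 t : nat, halts_within M (encode_formula phi) t &
      t%:R <= C * 2 `^ (delta * n%:R).

(* Instances have pairwise distinct clauses, so their length is polynomial in
   the number [n] of variables; with repeated clauses a time bound in [n] alone
   would fail merely because the input could not be read. *)
Definition ETH (R : realType) : Prop :=
  exists2 delta : R, 0 < delta &
    ~ exists M : machine, solves_3sat M /\ sat_time M delta.

Record graph (n : nat) := Graph {
  adj : rel 'I_n;
  adj_sym : symmetric adj;
  adj_irrefl : irreflexive adj
}.

Definition dominating (n : nat) (G : graph n) (D : {set 'I_n}) : bool :=
  [forall v, (v \in D) || [exists u in D, adj G u v]].

Definition upper_dominating (n : nat) (G : graph n) (D : {set 'I_n}) : bool :=
  minset (dominating G) D.

(* The number of vertices and the parameter in unary, then the adjacency matrix
   row by row. *)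
Definition encode_instance (n : nat) (G : graph n) (k : nat) : seq bool :=
  unary n ++ unary k ++ [seq adj G i j | i <- enum 'I_n, j <- enum 'I_n].

Definition encode_set (n : nat) (D : {set 'I_n}) : seq bool :=
  [seq i \in D | i <- enum 'I_n].

Definition uds_approximation (R : realType) (r : R) (M : machine) : Prop :=
  forall (n : nat) (G : graph n) (k : nat),
    (exists t, halts_within M (encode_instance G k) t) /\
    ((exists2 D, upper_dominating G D & (k <= #|D|)%N) ->
     exists D : {set 'I_n},
       [/\ outputs M (encode_instance G k) (encode_set D),
           upper_dominating G D &
           Num.min r r^-1 * k%:R <= #|D|%:R]).

(* O(n^(k^(1-eps))) as a bound for large [n] and [k]: for small [k] it would be
   sublinear in the length of the adjacency matrix, and an algorithm meeting it
   there could not even read its input. *)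
Definition uds_time (R : realType) (M : machine) (eps : R) : Prop :=
  exists (C : R) (N : nat), forall (n : nat) (G : graph n) (k : nat),
    (N <= n)%N -> (N <= k)%N ->
    exists2 t : nat, halts_within M (encode_instance G k) t &
      t%:R <= C * n%:R `^ (k%:R `^ (1 - eps)).

(* Main.v *)
(* Upper domination allows a gap to be created without a PCP theorem, because a
   vertex of a minimal dominating set needs a private neighbour.

   Let phi be a 3-CNF with N variables and let p be a large constant prime.
   Arrange the variables as d rows by d * l columns, split the columns into d
   cells, and encode every column by a Reed-Solomon code of length p, so that
   distinct columns agree on fewer than d points. In the graph, the vertices
   b_g (g in F_p) can have as private neighbours only vertices p_(g,s), where s
   is a guess for row g of the encoded assignment. Vertices u_(h,x) carry an
   assignment x of cell h and are adjacent to the p_(g,s) that are inconsistent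
   with them; vertices v_e carry assignments of three cells, are adjacent to all
   p_(g,s), and, if these three assignments falsify a clause, can otherwise be
   dominated only by a u_(h,x) that differs from e in cell h. A satisfying
   assignment gives a minimal dominating set with all p vertices b_g.
   Conversely, counting members by the type of their private neighbours, a
   minimal dominating set of size at least 6d + 5 contains at least d of the b_g
   with private neighbours p_(g,s). These determine the assignment of every u
   in the set by the distance of the code, and as all v_e are dominated, no
   clause is falsified.

   The graph has 2^O(N log p / d) vertices. With p a constant and d
   proportional to p, a running time n^(p^(1 - eps)) is at most 2^(delta N) once
   p is large. A machine for 3-SAT writes down this graph, runs the approximation
   algorithm, reads an assignment off the u in its answer, and evaluates phi on
   it; no validity check of the answer is needed, since only the assignment is
   trusted. *)
From HB Require Import structures.
Require Import Defs.
From mathcomp Require Import all_boot all_order all_algebra.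
From mathcomp Require Import boolp reals sequences exp.
From mathcomp Require Import zify ring lra.

Set Implicit Arguments.
Unset Strict Implicit.
Unset Printing Implicit Defensive.

Import Order.TTheory GRing.Theory Num.Theory.

(** * Structured programs for multi-tape machines *)

Definition shift (d : direction) : int :=
  match d with MoveLeft => -1 | Stay => 0 | MoveRight => 1 end%R.

Section Program.
Variables (F A J : finType).

(** Cells carry absolute integer positions, so two tapes are compared by function extensionality and
    a move changes only the head position. *)
Definition ctape : Type := ((int -> option A) * int)%type.
Definition mem : Type := (F * (J -> ctape))%type.

Definition rd (t : ctape) : option A := t.1 t.2.

Definition wm (am : option A * direction) (t : ctape) : ctape :=
  (fun z => if z == t.2 then am.1 else t.1 z, t.2 + shift am.2)%R.

Lemma wm_move (t : ctape) d : wm (rd t, d) t = (t.1, t.2 + shift d)%R.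
Proof.
case: t => c h; rewrite /wm /rd /=; congr pair; apply: funext => z.
by case: eqP => [->|].
Qed.

Lemma wm_stay (t : ctape) : wm (rd t, Stay) t = t.
Proof. by rewrite wm_move addr0; case: t. Qed.

(* A component of finite control: [None] as next state means exit. *)
Record prog := Prog {
  pst : finType;
  pin : pst;
  pstep : pst -> F -> (J -> option A) ->
          option pst * F * (J -> option A * direction)
}.

Definition rstep (p : prog) (c : option (pst p) * mem) : option (pst p) * mem :=
  if c is (Some q, (f, tp)) then
    let: (q', f', am) := pstep q f (fun j => rd (tp j)) in
    (q', (f', fun j => wm (am j) (tp j)))
  else c.

(** Exit configurations are fixed by [rstep], so [t] is an upper bound on the exit time rather than
    its exact value; [exec_le] rests on this. *)
Definition exec (p : prog) (m : mem) (t : nat) (m' : mem) : Prop :=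
  iter t (@rstep p) (Some (pin p), m) = (None, m').

Lemma iter_rstep_None p t m : iter t (@rstep p) (None, m) = (None, m).
Proof. by elim: t => //= t ->. Qed.

Lemma exec_le p m t t' m' : t <= t' -> exec p m t m' -> exec p m t' m'.
Proof.
by move=> le_tt'; rewrite /exec -(subnK le_tt') iterD => ->; rewrite iter_rstep_None.
Qed.

Definition act (g : F -> (J -> option A) -> F * (J -> option A * direction)) :=
  @Prog unit tt (fun _ f sc => (None, (g f sc).1, (g f sc).2)).

Definition pseq (p q : prog) :=
  @Prog (pst p + pst q)%type (inl (pin p)) (fun s f sc =>
    match s with
    | inl s => let: (s', f', am) := pstep s f sc in
               (Some (if s' is Some s1 then inl s1 else inr (pin q)), f', am)
    | inr s => let: (s', f', am) := pstep s f sc in (omap inr s', f', am)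
    end).

Definition ite (b : F -> (J -> option A) -> bool) (p q : prog) :=
  @Prog (option (pst p + pst q)) None (fun s f sc =>
    match s with
    | None => (Some (Some (if b f sc then inl (pin p) else inr (pin q))), f,
               fun j => (sc j, Stay))
    | Some (inl s) => let: (s', f', am) := pstep s f sc in
                      (omap (Some \o inl) s', f', am)
    | Some (inr s) => let: (s', f', am) := pstep s f sc in
                      (omap (Some \o inr) s', f', am)
    end).

(** The state [None] evaluates the test. An exit [None] of the body turns into [Some None], which is
    that test state again. *)
Definition loop (b : F -> (J -> option A) -> bool) (p : prog) :=
  @Prog (option (pst p)) None (fun s f sc =>
    match s with
    | None => (if b f sc then Some (Some (pin p)) else None, f,
               fun j => (sc j, Stay))
    | Some s => let: (s', f', am) := pstep s f sc in (Some s', f', am)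
    end).

Lemma exec_act g f tp :
  exec (act g) (f, tp) 1
    ((g f (fun j => rd (tp j))).1,
     fun j => wm ((g f (fun j => rd (tp j))).2 j) (tp j)).
Proof. by []. Qed.

Lemma stay_all (tp : J -> ctape) : (fun j => wm (rd (tp j), Stay) (tp j)) = tp.
Proof. by apply: funext => j; rewrite wm_stay. Qed.

(** A component runs unchanged inside a composite program as long as its exit is the exit of the
    composite; this covers both branches of [ite] and the second half of [pseq]. *)
Lemma iter_embed p q (h : pst p -> pst q) t s m m' :
  (forall s f sc, pstep (h s) f sc =
     let: (s', f', am) := pstep s f sc in (omap h s', f', am)) ->
  iter t (@rstep p) (Some s, m) = (None, m') ->
  iter t (@rstep q) (Some (h s), m) = (None, m').
Proof.
move=> hE; elim: t s m => // t IH s [f tp]; rewrite !iterSr /= hE.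
case: pstep => [[[s'|] f'] am] /=; first exact: IH.
by rewrite !iter_rstep_None => -[<-].
Qed.

Lemma exec_seq p q m t1 m1 t2 m2 :
  exec p m t1 m1 -> exec q m1 t2 m2 -> exec (pseq p q) m (t1 + t2) m2.
Proof.
rewrite /exec /=; move: (pin p) => s + H2.
elim: t1 s m => // t IH s [f tp]; rewrite addSn !iterSr /=.
case: pstep => [[[s'|] f'] am] /=; first exact: IH.
rewrite iter_rstep_None => -[E]; subst m1; rewrite iterD.
suff -> : iter t2 (@rstep (pseq p q)) (Some (inr (pin q)), (f', fun j => wm (am j) (tp j)))
  = (None, m2) by exact: (@iter_rstep_None (pseq p q)).
by apply: iter_embed H2.
Qed.

Lemma exec_ite (b : F -> (J -> option A) -> bool) p q f tp t m' :
  exec (if b f (fun j => rd (tp j)) then p else q) (f, tp) t m' ->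
  exec (ite b p q) (f, tp) t.+1 m'.
Proof.
rewrite /exec iterSr /= stay_all; case: ifP => _ H.
  by apply: (@iter_embed p (ite b p q) (Some \o inl)) H.
by apply: (@iter_embed q (ite b p q) (Some \o inr)) H.
Qed.

Lemma exec_loop0 (b : F -> (J -> option A) -> bool) p f tp :
  b f (fun j => rd (tp j)) = false -> exec (loop b p) (f, tp) 1 (f, tp).
Proof. by move=> Hb; rewrite /exec /= Hb stay_all. Qed.

Lemma exec_loopS (b : F -> (J -> option A) -> bool) p f tp t1 m1 t2 m2 :
  b f (fun j => rd (tp j)) -> exec p (f, tp) t1 m1 -> exec (loop b p) m1 t2 m2 ->
  exec (loop b p) (f, tp) (t1 + t2).+1 m2.
Proof.
rewrite /exec iterSr /= => -> /=; rewrite stay_all; move: (pin p) (f, tp) => s m + H2.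
elim: t1 s m => // t IH s [{}f {}tp]; rewrite addSn !iterSr /=.
case: pstep => [[[s'|] f'] am] /=; first exact: IH.
rewrite iter_rstep_None => -[E]; subst m1; rewrite iterD H2.
exact: (@iter_rstep_None (loop b p)).
Qed.

Lemma exec_loop (b : F -> (J -> option A) -> bool) p (ms : nat -> mem) n t :
  (forall i, i < n -> b (ms i).1 (fun j => rd ((ms i).2 j)) /\
                      exec p (ms i) t (ms i.+1)) ->
  b (ms n).1 (fun j => rd ((ms n).2 j)) = false ->
  exec (loop b p) (ms 0) (n * t.+1).+1 (ms n).
Proof.
elim: n ms => [|n IH] ms Hs Hn.
  by case E: (ms 0) Hn => [f tp] /= Hn; apply: exec_loop0.
have := IH (fun i => ms i.+1) (fun i Hi => Hs i.+1 Hi) Hn.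
have [] := Hs 0 isT; case E: (ms 0) => [f tp] /= Hb Hp Hr.
have H := exec_loopS Hb Hp Hr.
by move: H; apply: exec_le; rewrite mulSn; lia.
Qed.

Definition skip := act (fun f sc => (f, fun j => (sc j, Stay))).

Definition pseqs (ps : seq prog) : prog := foldr pseq skip ps.

Lemma exec_skip m : exec skip m 1 m.
Proof. by case: m => f tp; rewrite /exec /= stay_all. Qed.

Definition upd (tp : J -> ctape) (j : J) (t : ctape) : J -> ctape :=
  fun i => if i == j then t else tp i.

Lemma upd_get tp j t : upd tp j t j = t.
Proof. by rewrite /upd eqxx. Qed.

Lemma upd_neq tp j t i : i != j -> upd tp j t i = tp i.
Proof. by rewrite /upd => /negPf ->. Qed.

Lemma upd_id tp j : upd tp j (tp j) = tp.
Proof. by apply: funext => i; rewrite /upd; case: eqP => [->|]. Qed.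

Lemma upd_upd tp j t t' : upd (upd tp j t) j t' = upd tp j t'.
Proof. by apply: funext => i; rewrite /upd; case: eqP. Qed.

Lemma updC tp i j t t' : i != j -> upd (upd tp i t) j t' = upd (upd tp j t') i t.
Proof.
move=> /eqP Hij; apply: funext => k; rewrite /upd.
by case: eqP => // ->; case: eqP => // E; case: Hij.
Qed.

Definition setr (g : F -> (J -> option A) -> F) :=
  act (fun f sc => (g f sc, fun j => (sc j, Stay))).

Definition move (j : J) (d : direction) :=
  act (fun f sc => (f, fun i => (sc i, if i == j then d else Stay))).

Definition write (j : J) (a : F -> (J -> option A) -> option A) (d : direction) :=
  act (fun f sc => (f, fun i => if i == j then (a f sc, d) else (sc i, Stay))).

Lemma exec_setr g f tp :
  exec (setr g) (f, tp) 1 (g f (fun j => rd (tp j)), tp).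
Proof. by rewrite /exec /= stay_all. Qed.

Lemma exec_move j d f tp c h : tp j = (c, h) ->
  exec (move j d) (f, tp) 1 (f, upd tp j (c, h + shift d)%R).
Proof.
move=> E; rewrite /exec /=; congr (_, (_, _)); apply: funext => i.
by rewrite wm_move /upd; case: eqP => [->|_]; rewrite ?E ?addr0 //; case: (tp i).
Qed.

Lemma exec_write j a d f tp c h : tp j = (c, h) ->
  exec (write j a d) (f, tp) 1
    (f, upd tp j (fun z => if z == h then a f (fun j => rd (tp j)) else c z, h + shift d)%R).
Proof.
move=> E; rewrite /exec /=; congr (_, (_, _)); apply: funext => i.
by rewrite /upd; case: eqP => [->|_]; rewrite ?E ?wm_stay.
Qed.

End Program.

(* [rep Q t T]: the cells of the list tape [t] and of the indexed tape [T] are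
   pairwise related by [Q], relative to the heads. *)
Section Represent.
Variables (A : finType) (Q : symbol -> option A -> Prop).

Definition rep (t : tape) (T : ctape A) : Prop :=
  [/\ Q t.1.2 (T.1 T.2),
      forall i : nat, Q (nth None t.1.1 i) (T.1 (T.2 - 1 - i%:Z)%R) &
      forall i : nat, Q (nth None t.2 i) (T.1 (T.2 + 1 + i%:Z)%R)].

Lemma rep_move t T a a' d : rep t T -> Q a a' ->
  rep (write_move (a, d) t) (wm (a', d) T).
Proof.
case: t T => [[l s] r] [c h] [/= Hs Hl Hr] Ha; case: d; split=> /=.
- by rewrite ifF; [have := Hl 0; rewrite nth0 subr0 | lia].
- by move=> i; rewrite ifF ?nth_behead; [have := Hl i.+1; congr (Q _ (c _)) | ]; lia.
- case=> [|i] /=; first by rewrite ifT //; lia.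
  by rewrite ifF; [have := Hr i; congr (Q _ (c _)) | ]; lia.
- by rewrite ifT //; lia.
- by move=> i; rewrite ifF; [have := Hl i; congr (Q _ (c _)) | ]; lia.
- by move=> i; rewrite ifF; [have := Hr i; congr (Q _ (c _)) | ]; lia.
- by rewrite ifF; [have := Hr 0; rewrite nth0 addr0 | lia].
- case=> [|i] /=; first by rewrite ifT //; lia.
  by rewrite ifF; [have := Hl i; congr (Q _ (c _)) | ]; lia.
- by move=> i; rewrite ifF ?nth_behead; [have := Hr i.+1; congr (Q _ (c _)) | ]; lia.
Qed.

End Represent.

(** * Compilation of structured programs into machines *)

Definition word_content (B : Type) (s : seq B) : int -> option B :=
  fun z => if z is Posz i then onth s i else None.

Section Compile.
(* Tape symbols are bits and elements of [X]; an abstract tape becomes a bundle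
   of concrete tapes, one for the bits and one for the indicator of every
   element of [X]. The input tape is [None]. *)
Variables (F X J : finType).
Local Notation A := (bool + X)%type.
Local Notation JJ := (option J).
Local Notation T := (JJ * option X)%type.

Definition sym_code (a : option A) (c : option X) : symbol :=
  match a, c with
  | Some (inl b), None => Some b
  | Some (inr x), Some y => if x == y then Some true else None
  | _, _ => None
  end.

Definition sym_decode (s : option X -> symbol) : option A :=
  if s None is Some b then Some (inl b)
  else omap inr [pick x | s (Some x) == Some true].

Lemma sym_codeK a : sym_decode (sym_code a) = a.
Proof.
case: a => [[b|x]|] //=; rewrite /sym_decode /=; case: pickP => //= y.
- by case: (x =P y) => // ->.
- by move/(_ x): y; rewrite !eqxx.
Qed.

(** The bits of the input tape have to sit on tape 0, where a machine finds its input and leaves its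
    result; the other labels are shifted by one. *)
Definition tape_index (u : T) : 'I_(#|{: T}|).+1 :=
  if u == (None, None) then ord0 else lift ord0 (enum_rank u).

Definition tape_label (i : 'I_(#|{: T}|).+1) : T :=
  if unlift ord0 i is Some k then enum_val k else (None, None).

Lemma tape_indexK u : tape_label (tape_index u) = u.
Proof.
rewrite /tape_label /tape_index; case: eqP => [->|_]; first by rewrite unlift_none.
by rewrite liftK enum_rankK.
Qed.

Variables (p : prog F A JJ) (f0 : F).

Definition compile : machine :=
  @Machine #|{: T}| (option (pst p) * F)%type (Some (pin p), f0)
    (fun q => q.1 == None)
    (fun q sc =>
       if q.1 is Some s then
         let: (s', f', am) := pstep s q.2
             (fun j => sym_decode (fun c => sc (tape_index (j, c)))) in
         ((s', f'), fun i => let: (j, c) := tape_label i in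
                             (sym_code (am j).1 c, (am j).2))
       else (q, fun i => (sc i, Stay))).

Definition compile_rel (c : option (pst p) * mem F A JJ) (k : config compile) :=
  cstate k = (c.1, c.2.1) /\
  forall j x, rep (fun s a => s = sym_code a x) (ctapes k (tape_index (j, x))) (c.2.2 j).

Lemma compile_step c k : compile_rel c k -> compile_rel (rstep c) (step k).
Proof.
case: c k => [q [f tp]] [st ct] [/= -> Htp]; rewrite /step /=.
case: q => [s|] //=.
have -> : (fun j => sym_decode (fun c =>
    [ffun i => scanned (ct i)] (tape_index (j, c)))) = fun j => rd (tp j).
  apply: funext => j; rewrite -[RHS]sym_codeK; congr sym_decode.
  by apply: funext => x; rewrite ffunE; case: (Htp j x).
case: pstep => [[s' f'] am] /=; split=> // j x /=; rewrite tape_indexK.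
have := Htp j x; rewrite /scanned; move=> H.
case Eam: (am j) => [a d]; apply: (@rep_move _ (fun s a => s = sym_code a x)) => //.
Qed.

Definition input_tapes (w : seq bool) : JJ -> ctape A :=
  fun j => (if j is Some _ then fun=> None else word_content (map inl w), 0%R).

Lemma compile_init w :
  compile_rel (Some (pin p), (f0, input_tapes w)) (init_config compile w).
Proof.
split=> // j x; rewrite /=.
have Eb : tape_index (None, None) = ord0 by rewrite /tape_index eqxx.
case: (eqVneq (tape_index (j, x)) ord0) => [E|ne].
  have : (j, x) = (None, None) by rewrite -[LHS]tape_indexK E -Eb tape_indexK.
  move=> [-> ->]; split=> /=.
  - by case: w.
  - move=> i; rewrite nth_nil /word_content.
    by have -> : (0 - 1 - i%:Z = Negz i)%R by lia.
  - move=> i; rewrite /word_content.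
    rewrite add0n; case: w {E} => [|b w] /=; first by rewrite nth_nil.
    by elim: w i => [|c w IH] [|i] //=.
have Hx : j = None -> x != None.
  by move=> Ej; apply: contra_neq ne => Ex; rewrite Ej Ex.
split=> /=; rewrite /input_tapes.
- by case: j x Hx {ne} => [j|] [x|] // Hx; [case: w | have := Hx erefl].
- move=> i; rewrite nth_nil; have -> : (0 - 1 - i%:Z = Negz i)%R by lia.
  by case: j {Hx ne}.
- move=> i; rewrite nth_nil.
  case: j x Hx {ne} => [j|] [x|] // Hx; last by have := Hx erefl.
  have -> : (0 + 1 + i%:Z = i.+1)%R by lia.
  rewrite /word_content; move: (i.+1) => k.
  by elim: w k => [|b w IH] [|k] //=; rewrite -IH.
Qed.

Lemma compile_exec w t f tp : exec p (f0, input_tapes w) t (f, tp) ->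
  halts_within compile w t /\
  exists c l a r, [/\ tp None = c,
     ctapes (run compile w t) ord0 = (l, a, r),
     a = sym_code (rd c) None &
     forall i : nat, nth None r i = sym_code (c.1 (c.2 + 1 + i%:Z)%R) None].
Proof.
rewrite /exec => E.
have : compile_rel (None, (f, tp)) (run compile w t).
  rewrite -E /run {E}; elim: t => [|t IH] /=; first exact: compile_init.
  exact: compile_step.
case=> Es Ht; split; first by rewrite /halts_within Es.
have := Ht None None; rewrite /tape_index eqxx.
case Et: (ctapes _ _) => [[l a] r] [/= Ha _ Hr].
by exists (tp None), l, a, r; split.
Qed.

(** The answer is written on the first blank behind the input. The next cell is blank as well, so
    the word read from the head consists of the bit [b] alone. *)
Lemma compile_outputs w t f tp b h : exec p (f0, input_tapes w) t (f, tp) ->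
  tp None = (fun z => if z == h then Some (inl b) else word_content (map inl w) z, h) ->
  h = Posz (size w) ->
  outputs compile w [:: b] /\ halts_within compile w t.
Proof.
move=> E Etp Eh; have [Hh [c [l [a [r [Ec Er Ea Hr]]]]]] := compile_exec E.
split=> //; exists t => //; rewrite /result Er.
move: Ea Hr; rewrite -Ec Etp /rd /= eqxx => -> /= Hr.
congr cons; have := Hr 0; rewrite ifF; last by lia.
rewrite Eh addr0 -PoszD /word_content.
have -> : onth [seq inl i | i <- w] (size w + 1) = None :> option A.
  by elim: w {E Er Hr Hh Eh Etp} => //= x w IH.
by case: r {Er Hr} => [|[x|] r].
Qed.

End Compile.

(** * The graph of a formula *)

Lemma leq_card_fibers (T I : finType) (S : {set T}) (f : T -> I) (B : {set I}) m :
  {in S, forall x, f x \in B} ->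
  (forall i, #|[set x in S | f x == i]| <= m) -> #|S| <= #|B| * m.
Proof.
move=> fB fib; rewrite -sum1_card (partition_big f (fun i => i \in B)) //=.
rewrite -sum_nat_const; apply: leq_sum => i _.
apply: leq_trans (fib i); rewrite -sum1_card; apply: eq_leq; apply: eq_bigl => x.
by rewrite inE.
Qed.

Lemma card_le2 (T : finType) (S : {set T}) :
  (forall x y z, x \in S -> y \in S -> z \in S -> x != y -> x != z -> y != z -> False) ->
  #|S| <= 2.
Proof.
move=> H; rewrite leqNgt; apply/negP => /card_gt2P [x [y [z [[xS yS zS]]]]] [xy yz zx].
by apply: (H x y z) => //; rewrite eq_sym.
Qed.

(** * Private neighbours in minimal dominating sets *)

Section Private.
Variables (n : nat) (G : graph n).
Implicit Types (x y : 'I_n) (D : {set 'I_n}).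

Definition cadj x y := (x == y) || adj G x y.

Definition private D x y := cadj x y && [forall x' in D, cadj x' y ==> (x' == x)].

Lemma dominatingP D : reflect (forall y, exists2 x, x \in D & cadj x y) (dominating G D).
Proof.
apply: (iffP forallP) => H y; have := H y.
- case/orP => [yD|/existsP[x /andP[xD xy]]]; first by exists y; rewrite /cadj ?eqxx.
  by exists x; rewrite /cadj ?xy ?orbT.
- case=> x xD /orP[/eqP <-|xy]; first by rewrite xD.
  by apply/orP; right; apply/existsP; exists x; rewrite xD.
Qed.

(** By minimality [D :\ x] leaves some vertex undominated; [D] dominates that vertex, hence only
    through [x]. *)
Lemma upper_dominating_private D x :
  upper_dominating G D -> x \in D -> exists y, private D x y.
Proof.
move=> /minsetP[/dominatingP domD minD] xD.
have : ~~ dominating G (D :\ x).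
  apply/negP => /minD /(_ (subD1set _ _)) E.
  by move: xD; rewrite -E !inE eqxx.
case/forallPn => y Hy; exists y.
have H x' : x' \in D -> cadj x' y -> x' = x.
  move=> x'D x'y; apply/eqP/negPn/negP => ne; move/negP: Hy; apply.
  have x'Dx : x' \in D :\ x by rewrite !inE ne.
  case/orP: x'y => [/eqP <-|x'y]; first by rewrite x'Dx.
  by apply/orP; right; apply/existsP; exists x'; rewrite x'Dx.
have [x' x'D x'y] := domD y; rewrite /private -{1}(H x' x'D x'y) x'y /=.
by apply/forall_inP => z zD; apply/implyP => zy; rewrite (H z zD zy).
Qed.

Definition prv D x := odflt x [pick y | private D x y].

Lemma prvP D x : upper_dominating G D -> x \in D -> private D x (prv D x).
Proof.
move=> uD xD; rewrite /prv; case: pickP => //= H.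
by have [y] := upper_dominating_private uD xD; rewrite H.
Qed.

Lemma prv_cadj D x : upper_dominating G D -> x \in D -> cadj x (prv D x).
Proof. by move=> uD xD; case/andP: (prvP uD xD). Qed.

Lemma prv_uniq D x x' : upper_dominating G D -> x \in D -> x' \in D ->
  cadj x' (prv D x) -> x' = x.
Proof.
move=> uD xD x'D H; case/andP: (prvP uD xD) => _ /forall_inP /(_ x' x'D).
by rewrite H => /eqP.
Qed.

End Private.

(* [Hb], [Hp], [Hu], [Hv] are the types of the vertices b_g, p_(g,s), u_(h,x) and
   v_e. The vertices of types [Hz] and [Hb] form a clique, and those of types
   [Hw] and [Hu] another one; [Hz] and [Hw] have no further neighbours, so each
   clique meets every dominating set and contains at most one private
   neighbour. *)
Inductive header (p t : nat) : Type :=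
  | Hz | Hw | Hb of 'F_p | Hp of 'F_p | Hu of 'I_t | Hv of 'I_t & 'I_t & 'I_t.
Arguments Hz {p t}.
Arguments Hw {p t}.

Section HeaderFinite.
Variables p t : nat.
Local Notation code := (bool + ('F_p + 'F_p) + ('I_t + 'I_t * 'I_t * 'I_t))%type.

Definition header_code (h : header p t) : code :=
  match h with
  | Hz => inl (inl true) | Hw => inl (inl false)
  | Hb g => inl (inr (inl g)) | Hp g => inl (inr (inr g))
  | Hu h => inr (inl h) | Hv a b c => inr (inr (a, b, c))
  end.

Definition header_decode (c : code) : header p t :=
  match c with
  | inl (inl true) => Hz | inl (inl false) => Hw
  | inl (inr (inl g)) => Hb t g | inl (inr (inr g)) => Hp t g
  | inr (inl h) => Hu p h | inr (inr (a, b, c)) => Hv p a b c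
  end.

Lemma header_codeK : cancel header_code header_decode.
Proof. by case. Qed.

HB.instance Definition _ := Finite.copy (header p t) (can_type header_codeK).
End HeaderFinite.

(** * Reed-Solomon codes of binary messages *)

Section Code.
Variables (p d : nat).

Definition msg := {ffun 'I_d -> bool}.

(** The bits of the message are the coefficients, taken as 0 and 1 in the field, so distinct
    messages give distinct polynomials. *)
Definition rs_poly (m : msg) : {poly 'F_p} := \poly_(j < d) (if insub j is Some j then (m j)%:R else 0)%R.

Definition rs (m : msg) (g : 'F_p) : 'F_p := (rs_poly m).[g]%R.

(** The difference of the two polynomials is nonzero and has degree less than [d], hence fewer than
    [d] roots. *)
Lemma rs_agree (m m' : msg) : m != m' -> #|[set g | rs m g == rs m' g]| < d.
Proof.
move=> ne; pose q := (rs_poly m - rs_poly m')%R.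
have q0 : q != 0%R.
  apply: contra ne => /eqP q0; apply/eqP/ffunP => j.
  have := congr1 (fun r : {poly 'F_p} => r`_j)%R q0.
  rewrite coefB !coef_poly ltn_ord coef0 valK => /eqP.
  rewrite subr_eq0; by case: (m j) (m' j) => [] [].
rewrite cardE; apply: leq_trans (max_poly_roots q0 _ (enum_uniq _)) _.
  apply/allP => g; rewrite mem_enum inE /root /rs => /eqP E.
  by rewrite hornerD hornerN E subrr.
apply: leq_trans (size_polyD _ _) _; rewrite size_polyN geq_max.
by rewrite !size_poly.
Qed.

End Code.

(** * The reduction graph *)

Section Reduction.
Variables (p d t N l : nat).
Hypotheses (d_gt0 : 0 < d) (t_gt0 : 0 < t).
Local Notation msg := (msg d).
Local Notation header := (header p t).
Local Notation W := (t * d).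
Local Notation rs := (@rs p d).

(* One column of each cell: the three messages are those of a vertex of type
   [Hv] (the first one serves [Hu]), the last component that of [Hp]. Every vertex
   carries all components; the unused ones only create twins. *)
Definition digit := (msg * msg * msg * {ffun 'I_t -> 'F_p})%type.
Implicit Types (a b : digit) (hx hy : header).

Definition col1 a : msg := a.1.1.1.
Definition col2 a : msg := a.1.1.2.
Definition col3 a : msg := a.1.2.
Definition syms a : {ffun 'I_t -> 'F_p} := a.2.

(* The variable [v] is bit [(v %% W) %% d] of the message of cell
   [(v %% W) %/ d] in column [v %/ W]. *)
Definition row_of (r : nat) : 'I_d := Ordinal (ltn_pmod r d_gt0).

(** The partial assignment carried by a vertex of type [Hv]. If its cells coincide, the earliest
    message counts. *)
Definition val_of hx a (r : nat) : option bool :=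
  if hx is Hv h1 h2 h3 then
    if r %/ d == h1 then Some (col1 a (row_of r))
    else if r %/ d == h2 then Some (col2 a (row_of r))
    else if r %/ d == h3 then Some (col3 a (row_of r))
    else None
  else None.

Definition falsified (pv : nat -> option bool) (phi : formula N) :=
  has (fun c : clause N => all (fun q : literal N => pv q.1 == Some (~~ q.2)) c) phi.

Definition bad phi hx (x : nat -> digit) := falsified (fun v => val_of hx (x (v %/ W)) (v %% W)) phi.

(** The edges that depend on types alone: three cliques, formed by [Hz] and [Hb], by [Hw] and [Hu],
    by [Hp] and [Hv], and the edges joining [Hb g] to [Hp g]. *)
Definition base hx hy : bool :=
  match hx, hy with
  | Hz, (Hz | Hb _) | Hb _, (Hz | Hb _) => true
  | Hw, (Hw | Hu _) | Hu _, (Hw | Hu _) => true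
  | (Hp _ | Hv _ _ _), (Hp _ | Hv _ _ _) => true
  | Hb g, Hp g' | Hp g, Hb g' => g == g'
  | _, _ => false
  end.

Definition differs (h h1 h2 h3 : 'I_t) a b :=
  [|| (h == h1) && (col1 a != col1 b), (h == h2) && (col1 a != col2 b)
    | (h == h3) && (col1 a != col3 b)].

Definition local hx hy a b : bool :=
  match hx, hy with
  | Hp g, Hu h => rs (col1 b) g != syms a h
  | Hu h, Hp g => rs (col1 a) g != syms b h
  | Hu h, Hv h1 h2 h3 => differs h h1 h2 h3 a b
  | Hv h1 h2 h3, Hu h => differs h h1 h2 h3 b a
  | _, _ => false
  end.

Definition isUV hx hy := if (hx, hy) is (Hu _, Hv _ _ _) then true else false.

(** Distinct vertices of equal type are always adjacent. Distinctness is tested on the strings,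
    since these are what the program writing the matrix has at hand. *)
Definition vadj phi hx (x : nat -> digit) hy (y : nat -> digit) : bool :=
  if hx == hy then [exists c : 'I_l, x c != y c]
  else [|| base hx hy, isUV hx hy && ~~ bad phi hy y, isUV hy hx && ~~ bad phi hx x
         | [exists c : 'I_l, local hx hy (x c) (y c)]].

Lemma vadj_sym phi hx x hy y : vadj phi hx x hy y = vadj phi hy y hx x.
Proof.
rewrite /vadj eq_sym; case: ifP => _.
  by apply: eq_existsb => c; rewrite eq_sym.
congr (_ || _); first by case: hx; case: hy => //= *; rewrite eq_sym.
rewrite orbCA; congr (_ || (_ || _)); apply: eq_existsb => c.
by case: hx; case: hy.
Qed.

Lemma vadj_irr phi hx x : vadj phi hx x hx x = false.
Proof. by rewrite /vadj eqxx; apply/existsP => -[c]; rewrite eqxx. Qed.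

Section Graph.
(** The vertices are known only through their labels: by [lab_inj] and [lab_surj] they correspond to
    the pairs of a type and a string of [l] digits. How they are numbered is left to the
    construction. *)
Variables (n : nat) (G : graph n) (phi : formula N).
Variables (hd : 'I_n -> header) (st : 'I_n -> nat -> digit).
Hypothesis N_le : N <= l * W.
Hypothesis adjE : forall u v, adj G u v = vadj phi (hd u) (st u) (hd v) (st v).
Hypothesis lab_inj : forall u v, hd u = hd v -> (forall c : 'I_l, st u c = st v c) -> u = v.
Hypothesis lab_surj : forall h (x : nat -> digit), exists2 u, hd u = h & forall c : 'I_l, st u c = x c.
Implicit Types (u v w : 'I_n).


Local Notation cadj := (cadj G).

(** Numbers the three cliques of [base]. *)
Definition cls hx : nat :=
  match hx with
  | Hz | Hb _ => 0 | Hw | Hu _ => 1 | Hp _ | Hv _ _ _ => 2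
  end.

Lemma cls_cadj u v : cls (hd u) = cls (hd v) -> cadj u v.
Proof.
rewrite /cadj; case: (eqVneq u v) => //= ne E; rewrite adjE /vadj.
case: ifP => [/eqP Eh|_].
  apply: contraT => /existsPn H; case/eqP: ne.
  by apply: lab_inj => // c; apply/eqP/negPn.
by apply/orP; left; case: (hd u) E; case: (hd v).
Qed.

Lemma cadj_neq u v : hd u <> hd v -> cadj u v = vadj phi (hd u) (st u) (hd v) (st v).
Proof.
by move=> ne; rewrite /cadj -adjE; case: eqP => // E; case: ne; rewrite E.
Qed.

Lemma cadj_z u v : hd v = Hz -> cadj u v -> cls (hd u) = 0.
Proof.
move=> Ev; case: (hd u =P hd v) => [->|ne]; first by rewrite Ev.
rewrite cadj_neq // /vadj; case: eqP => // _; rewrite Ev.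
by case: (hd u) => [||?|?|?|? ? ?] /=; rewrite ?andbF //= => /existsP[].
Qed.

Lemma cadj_w u v : hd v = Hw -> cadj u v -> cls (hd u) = 1.
Proof.
move=> Ev; case: (hd u =P hd v) => [->|ne]; first by rewrite Ev.
rewrite cadj_neq // /vadj; case: eqP => // _; rewrite Ev.
by case: (hd u) => [||?|?|?|? ? ?] /=; rewrite ?andbF //= => /existsP[].
Qed.

(** The case distinction behind [card_upper]: it lists the possible types of a member whose private
    neighbour lies in the third clique. *)
Lemma cadj_pv u v : cls (hd v) = 2 -> cadj u v ->
  [\/ cls (hd u) = 2, exists h, hd u = Hu p h
    | exists2 g, hd u = Hb t g & hd v = Hp t g].
Proof.
move=> Ev; case: (hd u =P hd v) => [E|ne]; first by rewrite -Ev E; constructor 1.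
rewrite cadj_neq // /vadj; case: eqP => // _.
case: (hd u) (hd v) Ev => [||g|g|h|? ? ?] [||g'|g'|h'|? ? ?] //= _;
  rewrite ?andbF //= => H; try (by case/existsP: H); try (by constructor 1).
- by constructor 3; exists g => //; case/orP: H => [/eqP ->|/existsP[]].
- by constructor 2; exists h.
- by constructor 2; exists h.
Qed.

Lemma cadj_bp u v g : hd u = Hb t g -> hd v = Hp t g -> cadj u v.
Proof.
by move=> Eu Ev; rewrite cadj_neq ?Eu ?Ev // /vadj /= eqxx.
Qed.

Definition consistent h g u v :=
  forall c : 'I_l, rs (col1 (st u c)) g = syms (st v c) h.

Lemma cadj_up u v h g : hd u = Hu p h -> hd v = Hp t g ->
  reflect (consistent h g u v) (~~ cadj u v).
Proof.
move=> Eu Ev; rewrite cadj_neq ?Eu ?Ev // /vadj /= negb_exists.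
apply: (iffP forallP) => H c; have := H c; first by move/negPn/eqP.
by move=> ->; rewrite eqxx.
Qed.

Lemma cadj_uv u v h h1 h2 h3 : hd u = Hu p h -> hd v = Hv p h1 h2 h3 ->
  cadj u v = ~~ bad phi (hd v) (st v) ||
             [exists c : 'I_l, differs h h1 h2 h3 (st u c) (st v c)].
Proof. by move=> Eu Ev; rewrite cadj_neq ?Eu ?Ev // /vadj /= Ev. Qed.

(** * Soundness: the structure of large minimal dominating sets *)

Section Upper.
Variable D : {set 'I_n}.
Hypothesis uD : upper_dominating G D.
Local Notation prv := (prv G D).

Lemma upper_dom y : exists2 x, x \in D & cadj x y.
Proof. by case/minsetP: uD => /dominatingP. Qed.

Lemma card_prv_z : #|[set x in D | cls (hd (prv x)) == 0]| <= 1.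
Proof.
have [z Ez _] := lab_surj Hz (fun=> ([ffun=> false], [ffun=> false], [ffun=> false], [ffun=> 0%R])).
have [e eD /(cadj_z Ez) Ee] := upper_dom z.
rewrite -(cards1 e); apply/subset_leq_card/subsetP => x; rewrite !inE.
case/andP => xD /eqP Ex; apply/eqP/esym/(prv_uniq uD xD eD)/cls_cadj.
by rewrite Ee Ex.
Qed.

Lemma card_prv_w : #|[set x in D | cls (hd (prv x)) == 1]| <= 1.
Proof.
have [z Ez _] := lab_surj Hw (fun=> ([ffun=> false], [ffun=> false], [ffun=> false], [ffun=> 0%R])).
have [e eD /(cadj_w Ez) Ee] := upper_dom z.
rewrite -[leqRHS](cards1 e); apply/subset_leq_card/subsetP => x; rewrite !inE.
case/andP => xD /eqP Ex; apply/eqP/esym/(prv_uniq uD xD eD)/cls_cadj.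
by rewrite Ee Ex.
Qed.

(** Every member in the third clique is adjacent to all private neighbours in that clique, so two
    such members cannot coexist. *)
Lemma card_prv_pv :
  #|[set x in D | (cls (hd x) == 2) && (cls (hd (prv x)) == 2)]| <= 1.
Proof.
apply/card_le1_eqP => x y; rewrite !inE => /and3P[xD /eqP Ex /eqP Epx] /and3P[yD /eqP Ey _].
by apply/(prv_uniq uD xD yD)/cls_cadj; rewrite Ey Epx.
Qed.

Definition cell u : 'I_t := if hd u is Hu h then h else Ordinal t_gt0.
Definition is_u hx := if hx is Hu _ then true else false.
Definition is_v hx := if hx is Hv _ _ _ then true else false.
Definition is_p hx := if hx is Hp _ then true else false.
Definition is_b hx := if hx is Hb _ then true else false.
Definition row u : 'F_p := if hd u is Hp g then g else 0%R.

Lemma is_uP u : is_u (hd u) -> hd u = Hu p (cell u).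
Proof. by rewrite /cell; case: (hd u). Qed.

Lemma is_pP u : is_p (hd u) -> hd u = Hp t (row u).
Proof. by rewrite /row; case: (hd u). Qed.

Lemma differs_mem h h1 h2 h3 h' a b : differs h h1 h2 h3 a b -> h = h' ->
  h' \in [:: h1; h2; h3].
Proof.
by move=> + <-; rewrite /differs !inE => /or3P[] /andP[-> _]; rewrite ?orbT.
Qed.

(* A private vertex in [V] pins down the strings of all other members of its
   cells, so a cell contains at most two such members. *)
Lemma card_prv_uv : #|[set x in D | is_u (hd x) && is_v (hd (prv x))]| <= 2 * t.
Proof.
rewrite mulnC -[t]card_ord -cardsT.
apply: (leq_card_fibers (f := cell)) => [x|h]; first by rewrite inE.
apply: card_le2 => x y z; rewrite !inE.
case/andP => /and3P[xD ux vx] /eqP Ex /andP[/and3P[yD uy vy] /eqP Ey].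
case/andP => /and3P[zD uz vz] /eqP Ez xy xz yz.
move: (is_uP ux) (is_uP uy) (is_uP uz); rewrite Ex Ey Ez => {}Ex {}Ey {}Ez.
case Ev: (hd (prv x)) vx => [||?|?|?|h1 h2 h3] // _.
have ny : ~~ cadj y (prv x).
  by apply: contra xy => /(prv_uniq uD xD yD) ->.
have nz : ~~ cadj z (prv x).
  by apply: contra xz => /(prv_uniq uD xD zD) ->.
have := prv_cadj uD xD; rewrite (cadj_uv Ex Ev).
move: ny nz; rewrite (cadj_uv Ey Ev) (cadj_uv Ez Ev) !negb_or negbK.
case/andP => -> /existsPn Hy /andP[_ /existsPn Hz] /= /existsP[c0 /differs_mem /(_ erefl) Hm].
(* With equal strings in the same cell, [y] and [z] have the same neighbours of type [Hv], so [z] is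
   adjacent to the private neighbour of [y]. *)
suff Eyz (c : 'I_l) : col1 (st y c) = col1 (st z c).
  case/eqP: yz; apply/esym/(prv_uniq uD yD zD); have := prv_cadj uD yD.
  case Evy: (hd (prv y)) vy => [||?|?|?|k1 k2 k3] // _.
  rewrite (cadj_uv Ey Evy) (cadj_uv Ez Evy); congr (_ || _).
  by apply: eq_existsb => c; rewrite /differs Eyz.
move: (Hy c) (Hz c); rewrite /differs !negb_or !negb_and !negbK.
move: Hm; rewrite !inE => /or3P[] /eqP <-; rewrite !eqxx /= => /and3P[Ha Hb Hc] /and3P[Ha' Hb' Hc'].
- by rewrite (eqP Ha) (eqP Ha').
- by rewrite (eqP Hb) (eqP Hb').
- by rewrite (eqP Hc) (eqP Hc').
Qed.


Let Sup := [set x in D | is_u (hd x) && is_p (hd (prv x))].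

Lemma prv_consistent x y : x \in D -> y \in D -> is_u (hd y) -> is_p (hd (prv x)) ->
  y != x -> consistent (cell y) (row (prv x)) y (prv x).
Proof.
move=> xD yD uy px ne; apply/(cadj_up (is_uP uy) (is_pP px)).
by apply: contra ne => /(prv_uniq uD xD yD) ->.
Qed.

Lemma prv_inconsistent x : x \in Sup ->
  exists c : 'I_l, rs (col1 (st x c)) (row (prv x)) != syms (st (prv x) c) (cell x).
Proof.
rewrite inE => /and3P[xD ux px]; apply/existsP; apply: contraT => /existsPn H.
have : ~~ cadj x (prv x).
  by apply/(cadj_up (is_uP ux) (is_pP px)) => c; apply/eqP/negPn.
by rewrite prv_cadj.
Qed.

Let alone := [set x in Sup | [forall y in Sup, (cell y == cell x) ==> (y == x)]].

Lemma card_alone : #|alone| <= t.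
Proof.
rewrite -[leqRHS]muln1 -[X in X * _]card_ord -cardsT.
apply: (leq_card_fibers (f := cell)) => [x|h]; first by rewrite inE.
apply/card_le1_eqP => x y /setIdP[/setIdP[xS /forall_inP Hx] /eqP Ex].
case/setIdP => /setIdP[yS _] /eqP Ey.
by apply/eqP/(implyP (Hx y yS)); rewrite Ex Ey.
Qed.

Lemma not_alone x : x \in Sup :\: alone ->
  exists y, [/\ y \in Sup, x \in Sup, cell y = cell x & y != x].
Proof.
case/setDP => xS /setIdP H.
case: (boolP [forall y in Sup, (cell y == cell x) ==> (y == x)]) => [Hx|]; first by case: H.
by case/forall_inPn => y yS; rewrite negb_imply => /andP[/eqP E ne]; exists y.
Qed.

(** Suppose that [x], [y], [z] have private neighbours in row [g], and let [e] share the cell of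
    [x]. One of [y], [z] differs from [e]; call it [w]. The private neighbour of [w] is consistent
    with [x] and [e], so these two agree at [g]. That of [x] is consistent with [e], hence also with
    [x], and is then not adjacent to [x]. *)
Lemma card_not_alone_row g : #|[set x in Sup :\: alone | row (prv x) == g]| <= 2.
Proof.
apply: card_le2 => x y z /setIdP[xS /eqP Ex] /setIdP[yS /eqP Ey] /setIdP[zS /eqP Ez] xy xz yz.
have [e [eS {}xS Ee ne]] := not_alone xS.
have {yS} yS : y \in Sup by case/setDP: yS.
have {zS} zS : z \in Sup by case/setDP: zS.
have [w [wS Ew xw ew]] : exists w, [/\ w \in Sup, row (prv w) = g, x != w & e != w].
  case: (eqVneq e y) => [E|]; last by exists y.
  by exists z; rewrite E.
have [c] := prv_inconsistent xS; case/eqP.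
move: xS eS wS; rewrite !inE => /and3P[xD ux px] /and3P[eD ue pe] /and3P[wD uw pw].
have H1 := prv_consistent wD xD ux pw xw c.
have H2 := prv_consistent wD eD ue pw ew c.
have H3 := prv_consistent xD eD ue px ne c.
by rewrite Ex -Ew H1 -Ee -H2 Ew -Ex H3.
Qed.

(** At most [t] members are alone in their cell. If [x] is not, it has a companion [y] whose string
    differs from that of [x] in some column, so their codewords there agree in fewer than [d] rows.
    The private neighbour of any further member is consistent with both and lies in one of these
    rows. Adding the rows of [x] and [y] gives at most [d + 1] rows, with at most two members
    each. *)
Lemma card_prv_up : #|Sup| <= t + (d + 1) * 2.
Proof.
rewrite -(cardsID alone) leq_add //.
  by apply: leq_trans card_alone; apply/subset_leq_card/subsetIr.
case: (set_0Vmem (Sup :\: alone)) => [->|[x /not_alone [y [yS xS E ne]]]].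
  by rewrite cards0.
have [c Hc] := prv_inconsistent xS.
pose R0 := [set g | rs (col1 (st x c)) g == rs (col1 (st y c)) g].
have ltR : #|R0| < d.
  apply: rs_agree; apply: contra Hc => /eqP ->; move: xS yS.
  rewrite !inE => /and3P[xD ux px] /and3P[yD uy py].
  by rewrite (prv_consistent xD yD uy px ne c) E.
pose R1 := R0 :|: [set row (prv x); row (prv y)].
have leR : #|R1| <= d + 1.
  apply: leq_trans (leq_card_setU _ _) _.
  rewrite cards2; apply: leq_trans (_ : #|R0| + 2 <= _); last by lia.
  by rewrite leq_add2l; case: eqP.
apply: leq_trans (_ : #|R1| * 2 <= _); last by rewrite leq_mul2r leR orbT.
apply: (leq_card_fibers (f := fun z => row (prv z))); last exact: card_not_alone_row.
move=> z /setDP[zS _]; rewrite !inE.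
case: (eqVneq z x) => [->|zx]; first by rewrite eqxx orbT.
case: (eqVneq z y) => [->|zy]; first by rewrite eqxx !orbT.
apply/orP; left; move: xS yS zS.
rewrite !inE => /and3P[xD ux px] /and3P[yD uy py] /and3P[zD uz pz].
rewrite (prv_consistent zD xD ux pz _ c) 1?eq_sym //.
by rewrite (prv_consistent zD yD uy pz _ c) ?E 1?eq_sym.
Qed.

Let Sbp := [set x in D | is_b (hd x) && is_p (hd (prv x))].

(** The members are sorted by their own type and that of their private neighbour. The five classes
    other than [Sbp] contribute 1, 1, 1, [2 * t] and [t + (d + 1) * 2]. *)
Lemma card_upper : #|D| <= #|Sbp| + 3 * t + 2 * d + 5.
Proof.
pose Sz := [set x in D | cls (hd (prv x)) == 0].
pose Sw := [set x in D | cls (hd (prv x)) == 1].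
pose Spv := [set x in D | (cls (hd x) == 2) && (cls (hd (prv x)) == 2)].
pose Suv := [set x in D | is_u (hd x) && is_v (hd (prv x))].
have sD : D \subset Sz :|: Sw :|: Spv :|: Suv :|: Sup :|: Sbp.
  apply/subsetP => x xD; rewrite !inE xD /=.
  case E2: (cls (hd (prv x)) == 2); last by case: (hd (prv x)) E2.
  have := cadj_pv (eqP E2) (prv_cadj uD xD).
  case=> [->|[h ->]|[g -> ->]]; rewrite ?eqxx ?orbT //.
  by case: (hd (prv x)) E2 => //= *; rewrite ?orbT.
apply: leq_trans (subset_leq_card sD) _.
have U (A B : {set 'I_n}) i j : #|A| <= i -> #|B| <= j -> #|A :|: B| <= i + j.
  by move=> Ha Hb; apply: leq_trans (leq_card_setU _ _) (leq_add Ha Hb).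
apply: leq_trans (_ : 1 + 1 + 1 + 2 * t + (t + (d + 1) * 2) + #|Sbp| <= _); last by lia.
apply: (U) (leqnn _); apply: (U) card_prv_up; apply: (U) card_prv_uv; apply: (U) card_prv_pv.
exact: (U) card_prv_z card_prv_w.
Qed.

Definition rows := [set row (prv x) | x in Sbp].

Lemma SbpP x : x \in Sbp ->
  [/\ x \in D, hd x = Hb t (row (prv x)) & hd (prv x) = Hp t (row (prv x))].
Proof.
rewrite inE => /and3P[xD bx px]; split=> //; last exact: is_pP.
have := cadj_pv _ (prv_cadj uD xD); rewrite (is_pP px) => /(_ erefl).
by case: (hd x) bx => // g' _ [|[]|[g'' [->] [->]]].
Qed.

Lemma rowsP g : g \in rows -> exists x, [/\ x \in D, hd x = Hb t g & hd (prv x) = Hp t g].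
Proof. by case/imsetP => x xS ->; exists x; apply: SbpP. Qed.

(** The threshold exceeds the bound of [card_upper] on the members outside [Sbp] by [d]. Members of
    [Sbp] have distinct rows, because [Hb g] is adjacent to every vertex of type [Hp g]. *)
Lemma card_rows : #|D| >= 3 * t + 3 * d + 5 -> #|rows| >= d.
Proof.
move=> H; rewrite card_in_imset.
  have := leq_trans H card_upper; move: #|Sbp| => k; lia.
move=> x y /SbpP[xD bx px] /SbpP[yD by_ py] E.
by apply: (prv_uniq uD yD xD); apply: (@cadj_bp _ _ (row (prv y))); rewrite // bx E.
Qed.

Hypothesis big : #|D| >= 3 * t + 3 * d + 5.

Lemma rows_ex : exists g, g \in rows.
Proof. by apply/card_gt0P; apply: leq_trans (card_rows big). Qed.

(** A member in the third clique would be adjacent to the private neighbour, of type [Hp], of some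
    member of type [Hb]. *)
Lemma upper_no_pv x : x \in D -> cls (hd x) <> 2.
Proof.
move=> xD Ex; have [g /rowsP[y [yD Ey Epy]]] := rows_ex.
have E : x = y by apply: (prv_uniq uD yD xD); apply: cls_cadj; rewrite Ex Epy.
by move: Ex; rewrite E Ey.
Qed.

(** Both members are consistent with the private neighbours in at least [d] rows, so their codewords
    agree at [d] points in every column, and the code distance makes the messages equal. *)
Lemma upper_cell_inj x y h : x \in D -> y \in D -> hd x = Hu p h -> hd y = Hu p h ->
  forall c : 'I_l, col1 (st x c) = col1 (st y c).
Proof.
move=> xD yD Ex Ey c; apply/eqP/negPn/negP => /(@rs_agree p) /leq_trans /(_ (card_rows big)).
rewrite ltnNge => /negP; apply; apply/subset_leq_card/subsetP => g.
case/rowsP => b [bD Eb Epb]; rewrite inE.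
have C w : w \in D -> hd w = Hu p h -> consistent h g w (prv b).
  move=> wD Ew; apply/(cadj_up Ew Epb); apply/negP => /(prv_uniq uD bD wD) E.
  by move: Ew; rewrite E Eb.
by rewrite (C x xD Ex c) (C y yD Ey c).
Qed.

(** For a falsified clause, the vertex of type [Hv] carrying the values of [a] on the cells of the
    clause is bad. It can then be dominated only by a member of type [Hu] that disagrees with [a],
    and there is none. *)
Lemma upper_sat (a : nat -> bool) :
  (forall x h, x \in D -> hd x = Hu p h ->
     forall (c : 'I_l) (j : 'I_d), a (c * W + (h * d + j)) = col1 (st x c) j) ->
  falsified (fun i => Some (a i)) phi = false.
Proof.
move=> agree; apply/negP => /hasP[cl clphi /allP Hcl].
have cell_lt (v : 'I_N) : (v %% W) %/ d < t.
  by rewrite ltn_divLR // ltn_pmod // muln_gt0 t_gt0.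
pose hc (v : 'I_N) := Ordinal (cell_lt v).
pose q1 := tnth cl (@Ordinal 3 0 isT); pose q2 := tnth cl (@Ordinal 3 1 isT).
pose q3 := tnth cl (@Ordinal 3 2 isT).
pose m (h : 'I_t) (c : nat) : msg := [ffun j : 'I_d => a (c * W + (h * d + j))].
(* The three cells are those of the variables of the clause; they may coincide, in which case the
   messages coincide too. *)
have [v Ev Hv0] := lab_surj (Hv p (hc q1.1) (hc q2.1) (hc q3.1))
  (fun c => (m (hc q1.1) c, m (hc q2.1) c, m (hc q3.1) c, [ffun=> 0%R])).
have val1 (q : literal N) : hc q.1 \in [:: hc q1.1; hc q2.1; hc q3.1] ->
    val_of (hd v) (st v (q.1 %/ W)) (q.1 %% W) = Some (a q.1).
  have ltc : q.1 %/ W < l.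
    by rewrite ltn_divLR ?muln_gt0 ?t_gt0 // (leq_trans (ltn_ord _) N_le).
  rewrite (Hv0 (Ordinal ltc)) Ev /= => Hin.
  have mE (h : 'I_t) : q.1 %% W %/ d = h :> nat -> m h (q.1 %/ W) (row_of (q.1 %% W)) = a q.1.
    move=> Eh; rewrite ffunE /= -Eh; congr a.
    by rewrite -divn_eq -divn_eq.
  rewrite /col1 /col2 /col3 /=.
  case: eqP => [E|n1]; first by rewrite mE.
  case: eqP => [E|n2]; first by rewrite mE.
  case: eqP => [E|n3]; first by rewrite mE.
  by move: Hin; rewrite !inE -!val_eqE /= => /or3P[] /eqP.
have cl_in q : q \in cl -> hc q.1 \in [:: hc q1.1; hc q2.1; hc q3.1].
  case/tnthP => i ->; rewrite !inE.
  have : [|| i == @Ordinal 3 0 isT, i == @Ordinal 3 1 isT | i == @Ordinal 3 2 isT].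
    by case: i => -[|[|[|]]].
  by case/or3P => /eqP ->; rewrite eqxx ?orbT.
have badv : bad phi (hd v) (st v).
  apply/hasP; exists cl => //; apply/allP => q qcl.
  by rewrite val1 ?cl_in //; apply: Hcl.
have [x xD xv] := upper_dom v.
have := cadj_pv _ xv; rewrite Ev => /(_ erefl) [Ex|[h Ex]|[g //]].
  exact: upper_no_pv Ex.
move: xv; rewrite (cadj_uv Ex Ev) badv /= => /existsP[c].
have mE h' : h = h' -> col1 (st x c) = m h' c.
  by move=> <-; apply/ffunP => j; rewrite ffunE (agree _ _ xD Ex).
rewrite Hv0 /differs /col1 /col2 /col3 /= -/(col1 _).
by case/or3P => /andP[/eqP E]; rewrite (mE _ E) eqxx.
Qed.

End Upper.

(** The vertices [fb g], together with the vertices [fu h] that spell out a satisfying assignment,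
    dominate the graph. In a minimal dominating subset no [fb g] is missing: [fp g] is consistent
    with all [fu h], so within this set only [fb g] dominates it. *)
Lemma sat_upper : prime p -> satisfiable phi ->
  exists2 D, upper_dominating G D & p <= #|D|.
Proof.
move=> p_pr /existsP[s /allP Hs].
pose a (v : nat) := if insub v is Some v then s v else false.
pose m (h : 'I_t) (c : nat) : msg := [ffun j : 'I_d => a (c * W + (h * d + j))].
pose m0 : msg := [ffun=> false].
have/choice [fb Hfb] : forall g, exists u, hd u = Hb t g.
  by move=> g; have [u Eu _] := lab_surj (Hb t g) (fun=> (m0, m0, m0, [ffun=> 0%R])); exists u.
have/choice [fu Hfu] : forall h, exists u, hd u = Hu p h /\
    forall c : 'I_l, col1 (st u c) = m h c.
  move=> h; have [u Eu Hu0] := lab_surj (Hu p h) (fun c => (m h c, m0, m0, [ffun=> 0%R])).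
  by exists u; split=> // c; rewrite Hu0.
have/choice [fp Hfp] : forall g, exists u, hd u = Hp t g /\
    forall (c : 'I_l) h, syms (st u c) h = rs (m h c) g.
  move=> g; have [u Eu Hu0] := lab_surj (Hp t g)
    (fun c => (m0, m0, m0, [ffun h => rs (m h c) g])).
  by exists u; split=> // c h; rewrite Hu0 /syms ffunE.
pose D0 := [set fb g | g : 'F_p] :|: [set fu h | h : 'I_t].
have inb g : fb g \in D0 by rewrite inE imset_f.
have inu h : fu h \in D0 by rewrite inE imset_f ?orbT.
have dom0 : dominating G D0.
  apply/dominatingP => v; case Ev: (hd v) => [||g|g|h|h1 h2 h3].
  - by exists (fb 0%R) => //; apply: cls_cadj; rewrite Hfb Ev.
  - by exists (fu (Ordinal t_gt0)) => //; apply: cls_cadj; rewrite (Hfu _).1 Ev.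
  - by exists (fb 0%R) => //; apply: cls_cadj; rewrite Hfb Ev.
  - by exists (fb g) => //; apply: (cadj_bp (Hfb g)).
  - by exists (fu h) => //; apply: cls_cadj; rewrite (Hfu _).1 Ev.
  - case: (boolP (bad phi (hd v) (st v))) => [|nb]; last first.
      by exists (fu h1) => //; rewrite (cadj_uv (Hfu h1).1 Ev) nb.
    (* The strings of [v] falsify [cl], whereas [s] makes some literal [q] of [cl] true. In the cell
       of [q], the vertex chosen by [fu] therefore differs from [v] and is adjacent to it. *)
    case/hasP => cl clphi /allP Hcl; have /hasP[q qcl /eqP Hq] := Hs cl clphi.
    have := Hcl q qcl; rewrite Ev /val_of.
    have ltc : q.1 %/ W < l.
      by rewrite ltn_divLR ?muln_gt0 ?t_gt0 // (leq_trans (ltn_ord _) N_le).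
    have mE (h : 'I_t) : q.1 %% W %/ d = h :> nat ->
        m h (q.1 %/ W) (row_of (q.1 %% W)) = q.2.
      move=> Eh; rewrite ffunE /= -Eh -divn_eq -divn_eq /a valK.
      exact: Hq.
    have K (h : 'I_t) : q.1 %% W %/ d = h :> nat -> forall b : msg,
        Some (b (row_of (q.1 %% W))) == Some (~~ q.2) -> col1 (st (fu h) (q.1 %/ W)) != b.
      move=> Eh b /eqP[Eb]; have /= -> := (Hfu h).2 (Ordinal ltc).
      by apply/eqP => Em; move: Eb; rewrite -Em (mE _ Eh); case: (q.2).
    case: (q.1 %% W %/ d =P h1) => [E /(K _ E) ne|_].
      exists (fu h1) => //; rewrite (cadj_uv (Hfu h1).1 Ev); apply/orP; right.
      by apply/existsP; exists (Ordinal ltc); rewrite /differs eqxx /= ne.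
    case: (q.1 %% W %/ d =P h2) => [E /(K _ E) ne|_].
      exists (fu h2) => //; rewrite (cadj_uv (Hfu h2).1 Ev); apply/orP; right.
      by apply/existsP; exists (Ordinal ltc); rewrite /differs eqxx /= ne !orbT.
    case: (q.1 %% W %/ d =P h3) => [E /(K _ E) ne|//].
    exists (fu h3) => //; rewrite (cadj_uv (Hfu h3).1 Ev); apply/orP; right.
    by apply/existsP; exists (Ordinal ltc); rewrite /differs eqxx /= ne !orbT.
have [D minD sD] := minset_exists dom0; exists D => //.
have fb_inj : injective fb by move=> g g' E; have := Hfb g; rewrite E Hfb => -[].
have <- : #|'F_p| = p by rewrite card_Fp.
rewrite -cardsT -(card_imset _ fb_inj); apply/subset_leq_card/subsetP => _ /imsetP[g _ ->].
have [/dominatingP domD _] := minsetP minD.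
have [x xD xp] := domD (fp g).
suff <- : x = fb g by [].
have := subsetP sD x xD; rewrite inE => /orP[] /imsetP[g' _ Ex].
  have := cadj_pv _ xp; rewrite (Hfp g).1 => /(_ erefl); rewrite Ex Hfb.
  by case=> [//|[]//|[g'' [->] [->]]].
have := cadj_up (Hfu g').1 (Hfp g).1; rewrite -Ex xp /=.
move/elimF => /(_ erefl) []; move=> c.
by rewrite Ex (Hfu g').2 (Hfp g).2.
Qed.

End Graph.
End Reduction.

(** * Tape subroutines *)

Section Zipper.
Variable A : finType.
Implicit Types (pre rest : seq A) (a : A).

(** A zipper: the head is on the first symbol of [rest], or on the blank behind the word if [rest]
    is empty. *)
Definition zt pre rest : ctape A := (word_content (pre ++ rest), Posz (size pre)).

Lemma onth_cat_size pre rest : onth (pre ++ rest) (size pre) = ohead rest.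
Proof. by elim: pre => //=; case: rest. Qed.

Lemma onth_nth (a0 : A) s i : i < size s -> onth s i = Some (nth a0 s i).
Proof. by elim: s i => [|a s IH] [|i] // H; apply: IH. Qed.

Lemma rd_zt pre rest : rd (zt pre rest) = ohead rest.
Proof. exact: onth_cat_size. Qed.

Lemma zt_right pre a rest : ((zt pre (a :: rest)).1, Posz (size pre) + 1)%R = zt (rcons pre a) rest.
Proof. by rewrite /zt cat_rcons size_rcons /=; congr pair; lia. Qed.

Lemma zt_left pre a rest : ((zt (rcons pre a) rest).1, Posz (size (rcons pre a)) - 1)%R = zt pre (a :: rest).
Proof. by rewrite /zt cat_rcons size_rcons /=; congr pair; lia. Qed.

Lemma word_write pre a rest :
  (fun z => if z == Posz (size pre) then Some a else word_content (pre ++ rest) z) =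
  word_content (pre ++ a :: behead rest).
Proof.
apply: funext => -[i|i] //=; rewrite eqz_nat.
elim: pre i => [|x pre IH] [|i] //=; first by case: rest => //=; case: i.
by rewrite eqSS IH.
Qed.

End Zipper.

Section Basic.
Variables (F A J : finType).
Implicit Types (f : F) (tp : J -> ctape A) (w : J) (pre rest : seq A).
Local Notation prog := (prog F A J).
Local Notation move := (@move F A J).

Lemma exec_right w f tp pre a rest : tp w = zt pre (a :: rest) ->
  exec (move w MoveRight) (f, tp) 1 (f, upd tp w (zt (rcons pre a) rest)).
Proof. by move=> E; rewrite -zt_right; apply: exec_move. Qed.

Lemma exec_left w f tp pre a rest : tp w = zt (rcons pre a) rest ->
  exec (move w MoveLeft) (f, tp) 1 (f, upd tp w (zt pre (a :: rest))).
Proof. by move=> E; rewrite -zt_left; apply: exec_move. Qed.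

Lemma exec_write_right w g f tp pre rest a : tp w = zt pre rest ->
  g f (fun j => rd (tp j)) = Some a ->
  exec (write w g MoveRight) (f, tp) 1 (f, upd tp w (zt (rcons pre a) (behead rest))).
Proof.
move=> E Eg; have := exec_write g MoveRight f E; rewrite Eg word_write.
rewrite /zt cat_rcons size_rcons.
by have -> : Posz (size pre).+1 = (Posz (size pre) + 1)%R by lia.
Qed.

Lemma exec_write_stay w g f tp pre rest a : tp w = zt pre rest ->
  g f (fun j => rd (tp j)) = Some a ->
  exec (write w g Stay) (f, tp) 1 (f, upd tp w (zt pre (a :: behead rest))).
Proof.
by move=> E Eg; have := exec_write g Stay f E; rewrite Eg word_write /= addr0.
Qed.

Definition nonblank w (f : F) (sc : J -> option A) : bool := sc w != None.

(** The first move leaves the blank on which the head may stand behind the word. The loop then stops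
    at the blank in cell -1. *)
Definition rewind w : prog :=
  pseq (move w MoveLeft)
    (pseq (loop (nonblank w) (move w MoveLeft)) (move w MoveRight)).

Lemma exec_loop_left w f tp pre a rest : tp w = zt pre (a :: rest) ->
  exec (loop (nonblank w) (move w MoveLeft)) (f, tp) (2 * size pre + 3)
    (f, upd tp w (word_content (pre ++ a :: rest), -1)%R).
Proof.
elim/last_ind: pre a rest tp => [|pre b IH] a rest tp E.
  have H1 := @exec_move F A J w MoveLeft f tp _ _ E.
  apply: exec_le (exec_loopS _ H1 (exec_loop0 _ _)) => //.
    by rewrite /nonblank E rd_zt.
  by rewrite /nonblank upd_get.
have H1 := @exec_left w f tp _ _ _ E.
have H2 := IH _ _ (upd tp w (zt pre (b :: a :: rest))) (upd_get _ _ _).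
rewrite upd_upd in H2; rewrite cat_rcons.
apply: exec_le (exec_loopS _ H1 H2); first by rewrite size_rcons; lia.
by rewrite /nonblank E rd_zt.
Qed.

Lemma exec_rewind w f tp pre rest : tp w = zt pre rest ->
  exec (rewind w) (f, tp) (2 * size pre + 5) (f, upd tp w (zt [::] (pre ++ rest))).
Proof.
move=> E.
have HR tp' c : tp' w = (c, -1)%R -> exec (move w MoveRight) (f, tp') 1 (f, upd tp' w (c, 0)%R).
  by move=> E'; have := @exec_move F A J w MoveRight f tp' _ _ E'.
case/lastP: pre E => [|pre a] E.
  have H1 := @exec_move F A J w MoveLeft f tp _ _ E.
  have H2 := @exec_loop0 F A J (nonblank w) (move w MoveLeft) f (upd tp w (word_content rest, 0 - 1)%R).
  have H3 := HR _ _ (upd_get tp w (word_content rest, -1)%R).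
  rewrite upd_upd in H3.
  apply: exec_le (exec_seq H1 (exec_seq (H2 _) H3)) => //.
  by rewrite /nonblank upd_get.
have H1 := @exec_left w f tp _ _ _ E.
have H2 := exec_loop_left f (upd_get tp w (zt pre (a :: rest))).
rewrite upd_upd in H2.
have H3 := HR _ _ (upd_get tp w (word_content (pre ++ a :: rest), -1)%R).
rewrite upd_upd in H3.
rewrite cat_rcons; apply: exec_le (exec_seq H1 (exec_seq H2 H3)).
by rewrite size_rcons; lia.
Qed.

End Basic.

(* Numbers below [b ^ l] as strings of [l] digits, least significant first. *)
Section Digits.
Variables (b : nat) (b_gt0 : 0 < b).

Definition od (i : nat) : 'I_b := Ordinal (ltn_pmod i b_gt0).

Fixpoint digs (l i : nat) : seq 'I_b :=
  if l is l'.+1 then od i :: digs l' (i %/ b) else [::].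

Definition is_max (a : 'I_b) := a.+1 == b.

(** Addition of one with carry; the overflow of the maximal string is dropped, which yields the zero
    string. *)
Fixpoint sinc (s : seq 'I_b) : seq 'I_b :=
  if s is a :: s' then
    if is_max a then od 0 :: sinc s' else od a.+1 :: s'
  else [::].

Lemma size_digs l i : size (digs l i) = l.
Proof. by elim: l i => //= l IH i; rewrite IH. Qed.

Lemma sinc_digs l i : sinc (digs l i) = digs l i.+1.
Proof.
elim: l i => //= l IH i; rewrite /is_max /=.
have ltb := ltn_pmod i b_gt0; have Ei := divn_eq i b.
case: eqP => [E|/eqP ne].
  have Ei1 : i.+1 = (i %/ b).+1 * b by rewrite mulSn; lia.
  rewrite IH; congr cons; last by rewrite Ei1 mulnK.
  by apply: val_inj; rewrite /= Ei1 modnMl mod0n.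
have lt1 : (i %% b).+1 < b by rewrite ltn_neqAle ne.
have Ei1 : i.+1 = (i %/ b) * b + (i %% b).+1 by lia.
congr cons; last by rewrite Ei1 divnMDl // (divn_small lt1) addn0.
by apply: val_inj; rewrite /= Ei1 modnMDl.
Qed.

Lemma all_max_digs l i : i < b ^ l -> all is_max (digs l i) = (i.+1 == b ^ l).
Proof.
elim: l i => [|l IH] i /=; first by rewrite expn0; case: i.
rewrite expnS => lti; have lti' : i %/ b < b ^ l by rewrite ltn_divLR // mulnC.
rewrite IH // /is_max /=.
have ltb := ltn_pmod i b_gt0; have Ei := divn_eq i b.
apply/andP/eqP => [[/eqP E1 /eqP E2]|E]; first by rewrite -E2; lia.
suff E1 : (i %% b).+1 = b by split; apply/eqP => //; nia.
have E2 : (i %% b).+1 %% b = 0 by rewrite -(modnMDl (i %/ b)) addnS -Ei E modnMr.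
apply/eqP; rewrite eqn_leq ltb /= leqNgt; apply/negP => lt1.
by rewrite modn_small in E2.
Qed.

Lemma digs_wrap l : digs l (b ^ l) = digs l 0.
Proof.
elim: l => //= l IH; rewrite expnS mulKn // div0n IH; congr cons.
by apply: val_inj; rewrite /= modnMr mod0n.
Qed.

Lemma digs_inj l i j : i < b ^ l -> j < b ^ l -> digs l i = digs l j -> i = j.
Proof.
elim: l i j => [|l IH] i j; first by case: i j => [|i] [|j].
rewrite expnS => lti ltj /= [E /IH H]; rewrite (divn_eq i b) (divn_eq j b) E H //.
  by rewrite ltn_divLR // mulnC.
by rewrite ltn_divLR // mulnC.
Qed.

Lemma digs_surj l (x : nat -> 'I_b) : exists2 i, i < b ^ l & digs l i = mkseq x l.
Proof.
elim: l x => [|l IH] x; first by exists 0.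
have [i lti Ei] := IH (fun c => x c.+1); exists (i * b + x 0).
  have := ltn_ord (x 0); rewrite expnS; nia.
rewrite /= divnMDl // (divn_small (ltn_ord _)) addn0 Ei /mkseq /= (iotaDl 1 0) -map_comp.
by congr cons; apply: val_inj; rewrite /= modnMDl modn_small.
Qed.

(** This form follows the program [incp]: zeros are written over the leading maximal digits, and
    then at most one digit is raised. *)
Lemma sinc_split s : let k := find (predC is_max) s in
  sinc s = nseq k (od 0) ++ (if drop k s is a :: s' then od a.+1 :: s' else [::]).
Proof. by elim: s => //= a s IH; case: ifP => //= _; rewrite IH. Qed.

Lemma drop_find_max s : drop (find (predC is_max) s) s = [::] <-> all is_max s.
Proof.
elim: s => //= a s IH; case: (is_max a) => //=; exact: IH.
Qed.

End Digits.

#[local] Arguments rd : simpl never.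
#[local] Arguments zt : simpl never.

(** * The program for 3-SAT *)

Section Construction.
Variables (M : machine) (p d t : nat).
Hypotheses (d_gt0 : 0 < d) (t_gt0 : 0 < t).
Local Notation W := (t * d).
Local Notation digit := (digit p d t).
Local Notation header := (header p t).
Local Notation b := #|{: digit}|.

Lemma W_gt0 : 0 < W.
Proof. by rewrite muln_gt0 t_gt0. Qed.

Lemma b_gt0 : 0 < b.
Proof.
by apply/card_gt0P; exists ([ffun=> false], [ffun=> false], [ffun=> false], [ffun=> 0%R]).
Qed.

(** One column of assignment bits. A tape of such columns collects the assignment read off the
    answer of [M]. *)
Definition accd := {ffun 'I_W -> bool}.
(* Finite memory: the state of [M], a counter modulo [W] and three flags. *)
Definition reg := (state M * 'I_W * bool * bool * bool)%type.
Local Notation F := reg.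
Local Notation A := (bool + ('I_b + accd))%type.
Definition tape_name := option (option (option 'I_(extra_tapes M).+1)).
Local Notation JJ := (option tape_name).
Local Notation prog := (prog F A JJ).
Local Notation move := (@move F A JJ).
Local Notation od := (od b_gt0).
Local Notation digs := (digs b_gt0).
Local Notation sinc := (sinc b_gt0).
Implicit Types (f : F) (tp : JJ -> ctape A) (w : JJ).

(** [tI] is the input tape, [tX] and [tY] hold the strings of two vertices, [tA] the collected
    assignment, and the [tM i] are the tapes of [M]. *)
Definition tI : JJ := None.
Definition tX : JJ := Some None.
Definition tY : JJ := Some (Some None).
Definition tA : JJ := Some (Some (Some None)).
Definition tM i : JJ := Some (Some (Some (Some i))).

Definition c0 : 'I_W := Ordinal W_gt0.
Definition set_cnt f c : F := let: (q, _, x, y, z) := f in (q, c, x, y, z).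
Definition set_bad f x : F := let: (q, c, _, y, z) := f in (q, c, x, y, z).
Definition set_aux f y : F := let: (q, c, x, _, z) := f in (q, c, x, y, z).
Definition set_more f z : F := let: (q, c, x, y, _) := f in (q, c, x, y, z).
Definition get_cnt f : 'I_W := f.1.1.1.2.
Definition get_bad f : bool := f.1.1.2.
Definition get_aux f : bool := f.1.2.
Definition get_more f : bool := f.2.

Definition rg q mo : F := (q, c0, false, false, mo).

Definition dsym (a : 'I_b) : A := inr (inl a).
Definition asym (a : accd) : A := inr (inr a).
Definition bsym (x : bool) : A := inl x.

Definition at_max w f (sc : JJ -> option A) : bool :=
  if sc w is Some (inr (inl a)) then is_max a else false.

Definition next_sym (o : option A) : option A :=
  if o is Some (inr (inl a)) then Some (dsym (od a.+1)) else o.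

(** The flag [more] records whether the increment happened without overflow, that is, whether a loop
    over all strings has to go on. *)
Definition incp w : prog :=
  pseq (loop (at_max w) (write w (fun _ _ => Some (dsym (od 0))) MoveRight))
  (pseq (ite (nonblank w)
           (pseq (write w (fun _ sc => next_sym (sc w)) Stay) (setr (fun f _ => set_more f true)))
           (setr (fun f _ => set_more f false)))
        (rewind F A w)).

Lemma exec_inc_loop w f tp pre (s : seq 'I_b) : tp w = zt pre (map dsym s) ->
  let k := find (predC (@is_max b)) s in
  exec (loop (at_max w) (write w (fun _ _ => Some (dsym (od 0))) MoveRight)) (f, tp) (2 * size s + 1)
    (f, upd tp w (zt (pre ++ nseq k (dsym (od 0))) (map dsym (drop k s)))).
Proof.
elim: s pre tp => [|a s IH] pre tp E /=.
  rewrite cats0 -E upd_id; apply: exec_loop0.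
  by rewrite /at_max E rd_zt.
case Ea: (is_max a) => /=; last first.
  rewrite cats0 -[dsym a :: _]/(map dsym (a :: s)) -E upd_id.
  apply: exec_le (exec_loop0 _ _); first by lia.
  by rewrite /at_max E rd_zt /= Ea.
have H1 := @exec_write_right F A JJ w (fun _ _ => Some (dsym (od 0))) f tp _ _ _ E erefl.
have H2 := IH _ (upd tp w (zt (rcons pre (dsym (od 0))) (map dsym s))) (upd_get _ _ _).
move: H2; rewrite /= upd_upd cat_rcons => H2.
apply: exec_le (exec_loopS _ H1 H2); first by lia.
by rewrite /at_max E rd_zt.
Qed.

Lemma exec_inc w f tp (s : seq 'I_b) : tp w = zt [::] (map dsym s) ->
  exec (incp w) (f, tp) (4 * size s + 10)
    (set_more f (~~ all (@is_max b) s), upd tp w (zt [::] (map dsym (sinc s)))).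
Proof.
move=> E; have := exec_inc_loop f E; set k := find _ _ => /= H1.
have lek : k <= size s by apply: find_size.
set tp1 := upd _ _ _ in H1.
have E1 : tp1 w = zt (nseq k (dsym (od 0))) (map dsym (drop k s)) by rewrite /tp1 upd_get.
have Esinc := sinc_split b_gt0 s; rewrite -/k /= in Esinc.
case Ed: (drop k s) E1 Esinc => [|a s'] /= E1 Esinc.
  have -> : all (@is_max b) s by apply/drop_find_max.
  have H2 : exec (ite (nonblank w)
           (pseq (write w (fun _ sc => next_sym (sc w)) Stay) (setr (fun f _ => set_more f true)))
           (setr (fun f _ => set_more f false))) (f, tp1) 2 (set_more f false, tp1).
    by apply: exec_ite; rewrite /nonblank E1 rd_zt; apply: exec_setr.
  have H3 := exec_rewind (set_more f false) E1.
  rewrite upd_upd in H3; rewrite Esinc cats0 map_nseq -[nseq _ _]cats0.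
  by apply: exec_le (exec_seq H1 (exec_seq H2 H3)); rewrite size_nseq; lia.
have -> : all (@is_max b) s = false.
  by apply/negP => /drop_find_max; rewrite -/k Ed.
have H2 : exec (ite (nonblank w)
         (pseq (write w (fun _ sc => next_sym (sc w)) Stay) (setr (fun f _ => set_more f true)))
         (setr (fun f _ => set_more f false))) (f, tp1) 3
     (set_more f true, upd tp w (zt (nseq k (dsym (od 0))) (dsym (od a.+1) :: map dsym s'))).
  apply: exec_ite; rewrite /nonblank E1 rd_zt /=.
  have := @exec_write_stay F A JJ w (fun _ sc => next_sym (sc w)) f tp1 _ _ (dsym (od a.+1)) E1.
  rewrite E1 rd_zt /= upd_upd => /(_ erefl) H.
  by apply: (exec_seq H (exec_setr _ _ _)).
have H3 := exec_rewind (set_more f true) (upd_get tp w (zt (nseq k (dsym (od 0))) (dsym (od a.+1) :: map dsym s'))).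
rewrite upd_upd in H3; rewrite Esinc map_cat map_nseq /=.
by apply: exec_le (exec_seq H1 (exec_seq H2 H3)); rewrite size_nseq; lia.
Qed.

Definition dtape (s : seq 'I_b) : ctape A := zt [::] (map dsym s).

Definition for_strings w (body : prog) : prog :=
  pseq (setr (fun f _ => set_more f true))
       (loop (fun f _ => get_more f) (pseq body (incp w))).

(** The last increment overflows. This ends the loop and also restores the zero string, so such
    loops can be nested. *)
Lemma exec_for_strings w body q l tb (tps : nat -> JJ -> ctape A) mo :
  (forall i mo, i < b ^ l -> exists mo',
     exec body (rg q mo, upd (tps i) w (dtape (digs l i))) tb
               (rg q mo', upd (tps i.+1) w (dtape (digs l i)))) ->
  exec (for_strings w body) (rg q mo, upd (tps 0) w (dtape (digs l 0)))
    (b ^ l * (tb + 4 * l + 11) + 2)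
    (rg q false, upd (tps (b ^ l)) w (dtape (digs l 0))).
Proof.
move=> Hb; have H1 := @exec_setr F A JJ (fun f _ => set_more f true) (rg q mo)
  (upd (tps 0) w (dtape (digs l 0))).
pose ms i := (rg q (i < b ^ l), upd (tps i) w (dtape (digs l i))) : mem F A JJ.
have bl0 : 0 < b ^ l by rewrite expn_gt0 b_gt0.
have := @exec_loop F A JJ (fun f _ => get_more f) (pseq body (incp w)) ms (b ^ l) (tb + (4 * l + 10)).
rewrite /ms /= ltnn bl0 digs_wrap => H2.
apply: exec_le (exec_seq H1 (H2 _ _)) => //; first by lia.
move=> i lti; rewrite lti; split=> //.
have [mo' H3] := Hb i true lti; apply: (exec_seq H3).
have := @exec_inc w (rg q mo') _ _ (upd_get (tps i.+1) w (dtape (digs l i))).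
by rewrite size_digs upd_upd sinc_digs all_max_digs // ltn_neqAle lti andbT.
Qed.


Definition cO (k : nat) : 'I_W := Ordinal (ltn_pmod k W_gt0).
Definition at_true (f : F) (sc : JJ -> option A) : bool := sc tI == Some (bsym true).

(** * Evaluation of the formula under a partial assignment on a tape *)

Section Evaluate.
(** One evaluator serves all assignments: the variable [v] is looked up in cell [v %/ W] of tape
    [w], and [val] extracts the value at position [v %% W] from the symbol there, [None] meaning
    unknown. *)
Variables (w : JJ) (val : option A -> nat -> option bool).
Hypothesis w_neq : w != tI.

Definition tickp : prog :=
  pseq (move tI MoveRight)
  (pseq (ite (fun f _ => (get_cnt f).+1 == W) (move w MoveRight) (skip F A JJ))
        (setr (fun f _ => set_cnt f (ordS (get_cnt f))))).

Definition testp (sg : bool) : prog :=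
  setr (fun f sc => set_aux f (get_aux f && (val (sc w) (get_cnt f) == Some (~~ sg)))).

(** The variable is written in unary. While it is read, the counter runs modulo [W] and the head on
    [w] advances at each overflow, so that the two end up as remainder and quotient. *)
Definition litp (sg : bool) : prog :=
  pseq (setr (fun f _ => set_cnt f c0))
  (pseq (loop at_true tickp) (pseq (testp sg) (pseq (move tI MoveRight) (rewind F A w)))).

Lemma map_unary k rest : map bsym (unary k ++ rest) =
  nseq k (bsym true) ++ bsym false :: map bsym rest.
Proof. by rewrite /unary cat_rcons map_cat map_nseq. Qed.

Lemma ordS_cO i : ordS (cO i) = cO i.+1.
Proof. by apply: val_inj; rewrite /= -addn1 modnDml addn1. Qed.

Lemma exec_lit sg f tp pre k rest (s : seq A) :
  tp tI = zt pre (map bsym (unary k ++ rest)) -> tp w = zt [::] s -> k %/ W < size s ->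
  exec (litp sg) (f, tp) (5 * k + 2 * size s + 15)
    (set_aux (set_cnt f (cO k))
       (get_aux f && (val (onth s (k %/ W)) (k %% W) == Some (~~ sg))),
     upd tp tI (zt (pre ++ map bsym (unary k)) (map bsym rest))).
Proof.
move=> EI Ew ltk; rewrite map_unary in EI.
pose ms i := (set_cnt f (cO i),
  upd (upd tp tI (zt (pre ++ nseq i (bsym true)) (nseq (k - i) (bsym true) ++ bsym false :: map bsym rest)))
    w (zt (take (i %/ W) s) (drop (i %/ W) s))) : mem F A JJ.
have H0 := @exec_setr F A JJ (fun f _ => set_cnt f c0) f tp.
have E0 : (set_cnt f c0, tp) = ms 0.
  rewrite /ms div0n take0 drop0 cats0 subn0 -Ew; congr pair.
    by congr set_cnt; apply: val_inj; rewrite /= mod0n.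
  by rewrite -EI upd_id upd_id.
rewrite E0 in H0.
have msI i : (ms i).2 tI = zt (pre ++ nseq i (bsym true)) (nseq (k - i) (bsym true) ++ bsym false :: map bsym rest).
  by rewrite /ms /= upd_neq 1?eq_sym // upd_get.
have H1 : exec (loop at_true tickp) (ms 0) (k * 5).+1 (ms k).
  apply: exec_loop; last first.
    by rewrite /at_true msI rd_zt subnn.
  move=> i lti; split.
    by rewrite /at_true msI rd_zt -(subnSK lti).
  have lti' : i %/ W < size s by apply: leq_ltn_trans ltk; apply: leq_div2r; apply: ltnW.
  have := msI i; rewrite -(subnSK lti) /= => EIi.
  have T1 := @exec_right F A JJ tI (ms i).1 (ms i).2 _ _ _ EIi.
  rewrite [((ms i).1, (ms i).2)]surjective_pairing /= in T1.
  have -> : ms i.+1 = (set_cnt (set_cnt f (cO i)) (ordS (get_cnt (set_cnt f (cO i)))),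
      upd (upd tp tI (zt (rcons (pre ++ nseq i (bsym true)) (bsym true)) (nseq (k - i.+1) (bsym true) ++ bsym false :: map bsym rest)))
    w (zt (take (i.+1 %/ W) s) (drop (i.+1 %/ W) s))).
    rewrite /ms; congr pair; first by case: (f) => [[[[? ?] ?] ?] ?] /=; rewrite ordS_cO.
    by congr (upd (upd _ _ (zt _ _)) _ _); rewrite rcons_cat -cats1 -(nseqD _ 1) addn1.
  apply: (exec_seq (t2 := 3) T1); apply: (exec_seq (t2 := 1) (t1 := 2)); last exact: exec_setr.
  apply: exec_ite; rewrite (updC _ _ _ w_neq) upd_upd.
  have -> : get_cnt (set_cnt f (cO i)) = cO i by case: (f) => [[[[]]]].
  have ltm := ltn_pmod i W_gt0; have Ei := divn_eq i W.
  set tp1 := upd tp tI _.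
  case: ifP => /eqP E; last first.
    have -> : i.+1 %/ W = i %/ W.
      have lt1 : (i %% W).+1 < W by rewrite ltn_neqAle ltm andbT; apply/eqP; exact: E.
      by rewrite {1}Ei -addnS divnMDl ?W_gt0 // (divn_small lt1) addn0.
    exact: exec_skip.
  have -> : i.+1 %/ W = (i %/ W).+1 by rewrite {1}Ei -addnS -[X in _ + X]/((cO i).+1) E divnMDl ?W_gt0 // divnn W_gt0 addn1.
  pose s0 := bsym true; have Ed := drop_nth s0 lti'.
  have := @exec_right F A JJ w (set_cnt f (cO i)) (upd tp1 w (zt (take (i %/ W) s) (drop (i %/ W) s)))
    (take (i %/ W) s) (nth s0 s (i %/ W)) (drop (i %/ W).+1 s).
  by rewrite -Ed upd_get upd_upd (take_nth s0 lti'); apply.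
have H2 := @exec_setr F A JJ (fun f sc => set_aux f (get_aux f && (val (sc w) (get_cnt f) == Some (~~ sg)))) (ms k).1 (ms k).2.
have Ek : rd ((ms k).2 w) = onth s (k %/ W).
  rewrite /ms /= upd_get rd_zt -(onth_cat_size (take (k %/ W) s)).
  by rewrite cat_take_drop size_take ltk.
rewrite Ek in H2.
set f2 := set_aux _ _ in H2.
have Ef2 : f2 = set_aux (set_cnt f (cO k))
       (get_aux f && (val (onth s (k %/ W)) (k %% W) == Some (~~ sg))).
  by rewrite /f2 /ms /=; case: (f) => [[[[]]]].
rewrite -Ef2 {E0 Ef2}.
have := msI k; rewrite subnn /= => EIk.
have H3 := @exec_right F A JJ tI f2 (ms k).2 _ _ _ EIk.
have Ew3 : upd (ms k).2 tI (zt (rcons (pre ++ nseq k (bsym true)) (bsym false)) (map bsym rest)) w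
   = zt (take (k %/ W) s) (drop (k %/ W) s).
  by rewrite upd_neq // /ms /= upd_get.
have H4 := exec_rewind f2 Ew3.
rewrite [(ms k)]surjective_pairing in H1.
have := exec_seq H0 (exec_seq H1 (exec_seq H2 (exec_seq H3 H4))).
have -> : upd (upd (ms k).2 tI (zt (rcons (pre ++ nseq k (bsym true)) (bsym false)) [seq bsym i | i <- rest])) w
     (zt [::] (take (k %/ W) s ++ drop (k %/ W) s)) = upd tp tI (zt (pre ++ [seq bsym i | i <- unary k]) [seq bsym i | i <- rest]).
  rewrite cat_take_drop /ms /= -Ew; apply: funext => j; rewrite /upd.
  case: (eqVneq j w) => [->|jw]; first by rewrite (negPf w_neq).
  case: eqP => // _; congr zt.
  by rewrite /unary map_rcons map_nseq rcons_cat.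
by apply: exec_le; rewrite size_take ltk; lia.
Qed.

Definition literalp : prog :=
  ite at_true (pseq (move tI MoveRight) (litp true)) (pseq (move tI MoveRight) (litp false)).

(** Counter and [aux] are scratch values, so memories are compared only after resetting them. *)
Definition clean f : F := set_aux (set_cnt f c0) false.

Variables (N : nat) (s : seq A).
Hypothesis N_le : N <= size s * W.

Definition pval (v : nat) : option bool := val (onth s (v %/ W)) (v %% W).
Definition ltest (q : literal N) : bool := pval q.1 == Some (~~ q.2).
Local Notation unit_cost := (2 * size s + 20).

Lemma exec_literal f tp pre (q : literal N) rest :
  tp tI = zt pre (map bsym (encode_literal q ++ rest)) -> tp w = zt [::] s ->
  exec literalp (f, tp) (size (encode_literal q) * unit_cost)
    (set_aux (set_cnt f (cO q.1)) (get_aux f && ltest q),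
     upd tp tI (zt (pre ++ map bsym (encode_literal q)) (map bsym rest))).
Proof.
case: q => v sg EI Ew; rewrite /= in EI.
have H1 := @exec_right F A JJ tI f tp _ _ _ EI.
set tp1 := upd _ _ _ in H1.
have EI1 : tp1 tI = zt (rcons pre (bsym sg)) (map bsym (unary v ++ rest)) by rewrite /tp1 upd_get.
have Ew1 : tp1 w = zt [::] s by rewrite /tp1 upd_neq.
have ltv : v %/ W < size s by rewrite ltn_divLR ?W_gt0 //; apply: leq_trans N_le.
have H2 := exec_lit sg f EI1 Ew1 ltv.
have := @exec_ite F A JJ at_true (pseq (move tI MoveRight) (litp true)) (pseq (move tI MoveRight) (litp false)) f tp (1 + (5 * v + 2 * size s + 15))
  (set_aux (set_cnt f (cO v)) (get_aux f && ltest (v, sg)), upd tp tI (zt (pre ++ map bsym (encode_literal (v, sg))) (map bsym rest))).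
have -> : upd tp tI (zt (pre ++ map bsym (encode_literal (v, sg))) (map bsym rest)) =
    upd tp1 tI (zt (rcons pre (bsym sg) ++ map bsym (unary v)) (map bsym rest)).
  by rewrite /tp1 upd_upd cat_rcons.
move=> H; apply: exec_le (H _); last first.
  rewrite /at_true EI rd_zt /=; case: (sg) H1 H2 => /= H1 H2; exact: exec_seq H1 H2.
rewrite /= size_rcons size_nseq; nia.
Qed.

(** [aux] is the conjunction over the literals of the clause being false, and [bad] the disjunction
    over the clauses read so far. *)
Definition clausep : prog :=
  pseq (move tI MoveRight)
  (pseq (setr (fun f _ => set_aux f true))
  (pseq literalp (pseq literalp (pseq literalp
        (setr (fun f _ => set_bad f (get_bad f || get_aux f))))))).

Lemma exec_clause f tp pre (c : clause N) rest :
  tp tI = zt pre (map bsym (true :: encode_clause c ++ rest)) -> tp w = zt [::] s ->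
  exists f', clean f' = clean (set_bad f (get_bad f || all ltest c)) /\
  exec clausep (f, tp) ((size (encode_clause c)).+1 * unit_cost)
    (f', upd tp tI (zt (pre ++ map bsym (true :: encode_clause c)) (map bsym rest))).
Proof.
case: c => -[|q1 [|q2 [|q3 [|]]]] // c3; set c := Tuple _.
have -> : encode_clause c = encode_literal q1 ++ encode_literal q2 ++ encode_literal q3.
  by rewrite /encode_clause /= cats0.
have -> : all ltest c = [&& ltest q1, ltest q2 & ltest q3] by rewrite /= andbT.
rewrite -!catA !map_cons => EI Ew.
have H1 := @exec_right F A JJ tI f tp _ _ _ EI.
set tp1 := upd _ _ _ in H1.
have H2 := @exec_setr F A JJ (fun f _ => set_aux f true) f tp1.
have E1 : tp1 tI = zt (rcons pre (bsym true)) (map bsym (encode_literal q1 ++ encode_literal q2 ++ encode_literal q3 ++ rest)) by rewrite /tp1 upd_get.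
have Ew1 : tp1 w = zt [::] s by rewrite /tp1 upd_neq.
have H3 := exec_literal (set_aux f true) E1 Ew1.
set tp2 := upd tp1 _ _ in H3; set f2 := set_aux (set_cnt _ _) _ in H3.
have Ew2 : tp2 w = zt [::] s by rewrite /tp2 upd_neq.
have H4 := exec_literal f2 (upd_get tp1 tI _ : tp2 tI = _) Ew2.
set tp3 := upd tp2 _ _ in H4; set f3 := set_aux (set_cnt _ _) _ in H4.
have Ew3 : tp3 w = zt [::] s by rewrite /tp3 upd_neq.
have H5 := exec_literal f3 (upd_get tp2 tI _ : tp3 tI = _) Ew3.
set tp4 := upd tp3 _ _ in H5; set f4 := set_aux (set_cnt _ _) _ in H5.
have H6 := @exec_setr F A JJ (fun f _ => set_bad f (get_bad f || get_aux f)) f4 tp4.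
exists (set_bad f4 (get_bad f4 || get_aux f4)); split.
  rewrite /f4 /f3 /f2; case: (f) => [[[[? ?] ?] ?] ?] /=.
  by rewrite /clean /get_bad /get_aux /= !andbA.
have := exec_seq H1 (exec_seq H2 (exec_seq H3 (exec_seq H4 (exec_seq H5 H6)))).
have -> : tp4 = upd tp tI (zt (pre ++ bsym true :: map bsym (encode_literal q1 ++ encode_literal q2 ++ encode_literal q3)) (map bsym rest)).
  rewrite /tp4 /tp3 /tp2 /tp1 !upd_upd; congr (upd _ _ (zt _ _)).
  by rewrite -!catA cat_rcons !map_cat.
by apply: exec_le; rewrite !size_cat; nia.
Qed.

Definition body (phi : formula N) := flatten [seq true :: encode_clause c | c <- phi] ++ [:: false].

Lemma exec_clauses f tp pre (phi : formula N) :
  tp tI = zt pre (map bsym (body phi)) -> tp w = zt [::] s ->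
  exists f' pre' rest', [/\ clean f' = clean (set_bad f (get_bad f || has (fun c : clause N => all ltest c) phi)),
    pre' ++ rest' = pre ++ map bsym (body phi) &
    exec (loop at_true clausep) (f, tp) (size (body phi) * unit_cost.+1)
    (f', upd tp tI (zt pre' rest'))].
Proof.
elim: phi f tp pre => [|c phi IH] f tp pre EI Ew.
  exists f, pre, (map bsym (body [::])); split=> //.
    by rewrite orbF; case: (f) => [[[[]]]].
  rewrite -EI upd_id; apply: exec_le (exec_loop0 _ _) => //.
  by rewrite /at_true EI rd_zt.
have Eb : body (c :: phi) = (true :: encode_clause c) ++ body phi by rewrite /body /= catA.
rewrite Eb in EI *.
have [f1 [Ef1 H1]] := exec_clause f EI Ew.
set tp1 := upd _ _ _ in H1.
have Ew1 : tp1 w = zt [::] s by rewrite /tp1 upd_neq.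
have [f' [pre' [rest' [Ef' E' H2]]]] := IH f1 tp1 _ (upd_get tp tI _) Ew1.
exists f', pre', rest'; split.
- rewrite Ef' /= orbA.
  move: Ef1; case: (f1) => [[[[? ?] ?] ?] ?]; case: (f) => [[[[? ?] ?] ?] ?].
  by rewrite /clean /= => -[-> -> ->].
- by rewrite E' map_cat -catA.
rewrite /tp1 upd_upd in H2.
apply: exec_le (exec_loopS _ H1 H2); last by rewrite /at_true EI rd_zt.
by rewrite size_cat /=; nia.
Qed.

(** Puts the input head back in front of the first clause, behind the unary number of variables, so
    that the formula can be evaluated again. *)
Definition resetp : prog :=
  pseq (rewind F A tI) (pseq (loop at_true (move tI MoveRight)) (move tI MoveRight)).

Lemma exec_reset f tp pre rest (y : seq bool) : tp tI = zt pre rest ->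
  pre ++ rest = map bsym (unary N ++ y) ->
  exec resetp (f, tp) (2 * size pre + 2 * N + 7) (f, upd tp tI (zt (map bsym (unary N)) (map bsym y))).
Proof.
move=> EI E; have H1 := exec_rewind f EI; rewrite E map_unary in H1.
pose ms i := (f, upd tp tI (zt (nseq i (bsym true)) (nseq (N - i) (bsym true) ++ bsym false :: map bsym y))) : mem F A JJ.
have msI i : rd ((ms i).2 tI) = ohead (nseq (N - i) (bsym true) ++ bsym false :: map bsym y).
  by rewrite -(rd_zt (nseq i (bsym true))); congr rd; apply: upd_get.
have H2 : exec (loop at_true (move tI MoveRight)) (ms 0) (N * 2).+1 (ms N).
  apply: exec_loop; last by rewrite /at_true msI subnn.
  move=> i lti; split; first by rewrite /at_true msI -(subnSK lti).
  rewrite /ms -(subnSK lti) /=.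
  have := exec_right f (upd_get tp tI (zt (nseq i (bsym true)) (bsym true :: nseq (N - i.+1) (bsym true) ++ bsym false :: map bsym y))).
  by rewrite upd_upd -cats1 -(nseqD _ 1) addn1.
have H3 := exec_right f (upd_get tp tI (zt (nseq N (bsym true)) (bsym false :: map bsym y))).
rewrite upd_upd in H3; rewrite /ms subn0 subnn /= in H2.
rewrite /unary map_rcons map_nseq.
by apply: exec_le (exec_seq H1 (exec_seq H2 H3)); lia.
Qed.

Definition falsp : prog :=
  pseq (setr (fun f _ => set_bad f false))
  (pseq (loop at_true clausep) (pseq (setr (fun f _ => clean f)) resetp)).

Lemma exec_fals f tp (phi : formula N) :
  tp tI = zt (map bsym (unary N)) (map bsym (body phi)) -> tp w = zt [::] s ->
  exec falsp (f, tp) (size (encode_formula phi) * (unit_cost + 5) + 10)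
    (set_bad (clean f) (falsified pval phi), tp).
Proof.
move=> EI Ew.
have H1 := @exec_setr F A JJ (fun f _ => set_bad f false) f tp.
have [f' [pre' [rest' [Ef' E' H2]]]] := exec_clauses (set_bad f false) EI Ew.
have H3 := @exec_setr F A JJ (fun f _ => clean f) f' (upd tp tI (zt pre' rest')).
rewrite -map_cat in E'.
have H4 := exec_reset (clean f') (upd_get tp tI _) E'.
rewrite upd_upd -EI upd_id Ef' in H4; rewrite Ef' in H3.
have -> : set_bad (clean f) (falsified pval phi) =
    clean (set_bad (set_bad f false) (get_bad (set_bad f false) || has (fun c : clause N => all ltest c) phi)).
  by case: (f) => [[[[]]]].
have Hs : size (encode_formula phi) = N.+1 + size (body phi).
  by rewrite /encode_formula size_cat size_rcons size_nseq.
have Hp : size pre' <= N.+1 + size (body phi).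
  have := congr1 size E'; rewrite size_cat size_map size_cat size_rcons size_nseq.
  by move=> <-; apply: leq_addr.
apply: exec_le (exec_seq H1 (exec_seq H2 (exec_seq H3 H4))).
rewrite Hs; move: (size pre') (size (body phi)) Hp => i j Hp.
have : 20 <= 2 * size s + 20 by lia.
move: (2 * size s + 20) => u Hu.
have -> : (N.+1 + j) * (u + 5) = j * u.+1 + (4 * j + N.+1 * (u + 5)) by ring.
have : N.+1 * 25 <= N.+1 * (u + 5) by rewrite leq_mul2l; lia.
lia.
Qed.

End Evaluate.

Definition cfg (ti tx ty ta : ctape A) (mt : 'I_(extra_tapes M).+1 -> ctape A) : JJ -> ctape A :=
  fun j => match j with
  | None => ti | Some None => tx | Some (Some None) => ty
  | Some (Some (Some None)) => ta | Some (Some (Some (Some i))) => mt i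
  end.

Section Cfg.
Variables (ti tx ty ta : ctape A) (mt : 'I_(extra_tapes M).+1 -> ctape A).

Lemma cfgI z : upd (cfg ti tx ty ta mt) tI z = cfg z tx ty ta mt.
Proof. by apply: funext => -[[[[i|]|]|]|]. Qed.

Lemma cfgX z : upd (cfg ti tx ty ta mt) tX z = cfg ti z ty ta mt.
Proof. by apply: funext => -[[[[i|]|]|]|]. Qed.

Lemma cfgY z : upd (cfg ti tx ty ta mt) tY z = cfg ti tx z ta mt.
Proof. by apply: funext => -[[[[i|]|]|]|]. Qed.

Lemma cfgA z : upd (cfg ti tx ty ta mt) tA z = cfg ti tx ty z mt.
Proof. by apply: funext => -[[[[i|]|]|]|]. Qed.

Lemma cfgM i z : upd (cfg ti tx ty ta mt) (tM i) z = cfg ti tx ty ta (upd mt i z).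
Proof. by apply: funext => -[[[[j|]|]|]|]. Qed.

End Cfg.

(** * Nested loops over strings *)

Section Iterate.
Variables (S : Type) (P : S -> Prop) (q : state M).

(* [base x] are the tapes in state [x]. The last flag of the memory is a scratch
   value of the nested loops over strings, hence left unspecified. *)
Definition does (base : S -> JJ -> ctape A) (p0 : prog) (tb : nat) (g : S -> S) : Prop :=
  forall mo x, P x -> P (g x) /\
    exists mo', exec p0 (rg q mo, base x) tb (rg q mo', base (g x)).

Lemma does_seq base p1 p2 t1 t2 g1 g2 : does base p1 t1 g1 -> does base p2 t2 g2 ->
  does base (pseq p1 p2) (t1 + t2) (fun x => g2 (g1 x)).
Proof.
move=> H1 H2 mo x Px; have [Px1 [mo1 E1]] := H1 mo x Px.
have [Px2 [mo2 E2]] := H2 mo1 _ Px1; split=> //; exists mo2; exact: exec_seq E1 E2.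
Qed.

Lemma does_pseqs (I : Type) base (bd : I -> prog) tb (g : I -> S -> S) (hs : seq I) :
  (forall h, does base (bd h) tb (g h)) ->
  does base (pseqs [seq bd h | h <- hs]) (size hs * tb).+1
    (fun x => foldl (fun x h => g h x) x hs).
Proof.
move=> H; elim: hs => [|h hs IH] mo x Px.
  by split=> //; exists mo; apply: exec_skip.
have [Px1 [mo1 E1]] := H h mo x Px; have [Px2 [mo2 E2]] := IH mo1 _ Px1.
split=> //; exists mo2; apply: exec_le (exec_seq E1 E2).
by rewrite mulSn addnS.
Qed.

Lemma does_for w l base p0 tb (g : nat -> S -> S) :
  (forall i, i < b ^ l -> does (fun x => upd (base x) w (dtape (digs l i))) p0 tb (g i)) ->
  does (fun x => upd (base x) w (dtape (digs l 0))) (for_strings w p0)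
    (b ^ l * (tb + 4 * l + 11) + 2)
    (fun x => foldl (fun x i => g i x) x (iota 0 (b ^ l))).
Proof.
move=> H mo x Px.
pose y i := foldl (fun x i => g i x) x (iota 0 i).
have yS i : y i.+1 = g i (y i) by rewrite /y -addn1 iotaD foldl_cat.
have Py i : i <= b ^ l -> P (y i).
  elim: i => [//|i IH] lti; rewrite yS.
  by have [] := H i lti true (y i) (IH (ltnW lti)).
split; first exact: (Py (b ^ l)).
exists false; apply: (exec_for_strings (tps := fun i => base (y i))) => i mo1 lti.
have [_ [mo' E]] := H i lti mo1 _ (Py i (ltnW lti)).
by exists mo'; rewrite yS.
Qed.

End Iterate.

Section IterateTapes.
Variables (S : Type) (P : S -> Prop) (q : state M) (l : nat).
Variables (ti tx ty : ctape A) (ta : S -> ctape A) (mt : S -> 'I_(extra_tapes M).+1 -> ctape A).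
Variables (p0 : prog) (tb : nat) (g : nat -> S -> S).

Lemma does_forX :
  (forall i, i < b ^ l -> does P q (fun x => cfg ti (dtape (digs l i)) ty (ta x) (mt x)) p0 tb (g i)) ->
  does P q (fun x => cfg ti (dtape (digs l 0)) ty (ta x) (mt x)) (for_strings tX p0)
    (b ^ l * (tb + 4 * l + 11) + 2)
    (fun x => foldl (fun x i => g i x) x (iota 0 (b ^ l))).
Proof.
move=> H; have E i : (fun x => upd (cfg ti tx ty (ta x) (mt x)) tX (dtape (digs l i))) =
    (fun x => cfg ti (dtape (digs l i)) ty (ta x) (mt x)).
  by apply: funext => x; rewrite cfgX.
by rewrite -E; apply: does_for => i lti; rewrite E; apply: H.
Qed.

Lemma does_forY :
  (forall i, i < b ^ l -> does P q (fun x => cfg ti tx (dtape (digs l i)) (ta x) (mt x)) p0 tb (g i)) ->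
  does P q (fun x => cfg ti tx (dtape (digs l 0)) (ta x) (mt x)) (for_strings tY p0)
    (b ^ l * (tb + 4 * l + 11) + 2)
    (fun x => foldl (fun x i => g i x) x (iota 0 (b ^ l))).
Proof.
move=> H; have E i : (fun x => upd (cfg ti tx ty (ta x) (mt x)) tY (dtape (digs l i))) =
    (fun x => cfg ti tx (dtape (digs l i)) (ta x) (mt x)).
  by apply: funext => x; rewrite cfgY.
by rewrite -E; apply: does_for => i lti; rewrite E; apply: H.
Qed.

End IterateTapes.

Definition dig_of (o : option A) : digit :=
  if o is Some (inr (inl a)) then enum_val a else enum_val (od 0).

Definition xs (s : seq 'I_b) (c : nat) : digit := enum_val (nth (od 0) s c).

Definition scan_step (g : digit -> digit -> bool) : prog :=
  pseq (setr (fun f sc => set_aux f (get_aux f || g (dig_of (sc tX)) (dig_of (sc tY)))))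
       (pseq (move tX MoveRight) (move tY MoveRight)).

(** A parallel scan of both strings computes the quantifier over columns in [vadj]. *)
Definition scanp g : prog :=
  pseq (setr (fun f _ => set_aux f false))
  (pseq (loop (nonblank tX) (scan_step g)) (pseq (rewind F A tX) (rewind F A tY))).

Lemma set_aux2 f x y : set_aux (set_aux f x) y = set_aux f y.
Proof. by case: f => [[[[]]]]. Qed.

Lemma get_set_aux f x : get_aux (set_aux f x) = x.
Proof. by case: f => [[[[]]]]. Qed.

Lemma set_get_aux f : set_aux f (get_aux f) = f.
Proof. by case: f => [[[[]]]]. Qed.

Lemma exec_scan_loop g f ti ta mt pre1 pre2 (s1 s2 : seq 'I_b) : size s1 = size s2 ->
  exec (loop (nonblank tX) (scan_step g))
    (f, cfg ti (zt pre1 (map dsym s1)) (zt pre2 (map dsym s2)) ta mt) (4 * size s1 + 1)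
    (set_aux f (get_aux f || has (fun ab => g (enum_val ab.1) (enum_val ab.2)) (zip s1 s2)),
     cfg ti (zt (pre1 ++ map dsym s1) [::]) (zt (pre2 ++ map dsym s2) [::]) ta mt).
Proof.
elim: s1 s2 f pre1 pre2 => [|a1 s1 IH] [|a2 s2] f pre1 pre2 //= Es.
  by rewrite orbF !cats0 set_get_aux; apply: exec_loop0; rewrite /nonblank /= rd_zt.
set tp := cfg _ _ _ _ _.
set f1 := set_aux f (get_aux f || g (enum_val a1) (enum_val a2)).
have H1 : exec (scan_step g) (f, tp) 3
    (f1, cfg ti (zt (rcons pre1 (dsym a1)) (map dsym s1)) (zt (rcons pre2 (dsym a2)) (map dsym s2)) ta mt).
  have T1 := @exec_setr F A JJ (fun f sc => set_aux f (get_aux f || g (dig_of (sc tX)) (dig_of (sc tY)))) f tp.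
  rewrite /tp /= !rd_zt /= -/f1 -/tp in T1.
  have T2 := @exec_right F A JJ tX f1 tp _ _ _ erefl.
  rewrite cfgX in T2; set tp2 := cfg _ _ _ _ _ in T2.
  have T3 := @exec_right F A JJ tY f1 tp2 _ _ _ erefl.
  rewrite cfgY in T3; exact: exec_seq T1 (exec_seq T2 T3).
have := IH s2 f1 (rcons pre1 (dsym a1)) (rcons pre2 (dsym a2)) (succn_inj Es).
rewrite /f1 set_aux2 get_set_aux -orbA !cat_rcons => H2.
apply: exec_le (exec_loopS _ H1 H2); first by lia.
by rewrite /nonblank /tp /= rd_zt.
Qed.

Lemma has_zip_exists (g : digit -> digit -> bool) l (s1 s2 : seq 'I_b) :
  size s1 = l -> size s2 = l ->
  has (fun ab => g (enum_val ab.1) (enum_val ab.2)) (zip s1 s2) =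
  [exists c : 'I_l, g (xs s1 c) (xs s2 c)].
Proof.
move=> E1 E2; apply/(has_nthP (od 0, od 0))/existsP => [[i]|[c Hc]].
  rewrite size_zip E1 E2 minnn => lti; rewrite nth_zip ?E1 //= => Hg.
  by exists (Ordinal lti).
by exists c; rewrite ?size_zip ?E1 ?E2 ?minnn // nth_zip ?E1.
Qed.

Lemma exec_scan g f ti ta mt l (s1 s2 : seq 'I_b) : size s1 = l -> size s2 = l ->
  exec (scanp g) (f, cfg ti (dtape s1) (dtape s2) ta mt) (8 * l + 12)
    (set_aux f [exists c : 'I_l, g (xs s1 c) (xs s2 c)], cfg ti (dtape s1) (dtape s2) ta mt).
Proof.
move=> E1 E2; set tp := cfg _ _ _ _ _.
have H1 := @exec_setr F A JJ (fun f _ => set_aux f false) f tp.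
have := @exec_scan_loop g (set_aux f false) ti ta mt [::] [::] s1 s2.
rewrite E2 => /(_ E1); rewrite set_aux2 get_set_aux /= (has_zip_exists _ E1 E2).
set f1 := (X in exec _ _ _ (X, _)); set tp1 := (X in exec _ _ _ (_, X)) => H2.
have H3 := @exec_rewind F A JJ tX f1 tp1 _ _ erefl.
rewrite cfgX cats0 in H3; set tp2 := cfg _ _ _ _ _ in H3.
have H4 := @exec_rewind F A JJ tY f1 tp2 _ _ erefl.
rewrite cfgY cats0 in H4.
by apply: exec_le (exec_seq H1 (exec_seq H2 (exec_seq H3 H4))); rewrite !size_map E1 E2; lia.
Qed.

(** The instance is produced directly on tape 0 of [M], with the other tapes of [M] blank, so the
    simulation can start there after a rewind. *)
Definition gen (out : seq bool) : 'I_(extra_tapes M).+1 -> ctape A :=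
  fun i => if i == ord0 then zt (map bsym out) [::] else zt [::] [::].

Definition emitp (bit : F -> bool) : prog :=
  write (tM ord0) (fun f _ => Some (bsym (bit f))) MoveRight.

Lemma exec_emit bit f ti tx ty ta out :
  exec (emitp bit) (f, cfg ti tx ty ta (gen out)) 1
    (f, cfg ti tx ty ta (gen (rcons out (bit f)))).
Proof.
have E0 : cfg ti tx ty ta (gen out) (tM ord0) = zt (map bsym out) [::] by [].
have := @exec_write_right F A JJ (tM ord0) (fun f _ => Some (bsym (bit f))) f _ _ _ _ E0 erefl.
rewrite cfgM; congr (exec _ _ _ (_, cfg _ _ _ _ _)).
by apply: funext => i; rewrite /upd /gen map_rcons; case: eqP.
Qed.

Definition dval (hx : header) (o : option A) (r : nat) : option bool :=
  if o is Some (inr (inl a)) then val_of d_gt0 hx (enum_val a) r else None.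

Lemma eq_falsified N (pv pv' : nat -> option bool) (phi : formula N) :
  (forall v, v < N -> pv v = pv' v) -> falsified pv phi = falsified pv' phi.
Proof.
move=> E; apply: eq_has => c; apply: eq_all => x; by rewrite E.
Qed.

Lemma falsified_dval N l (phi : formula N) (s : seq 'I_b) hx : size s = l -> N <= l * W ->
  falsified (pval (dval hx) (map dsym s)) phi = bad d_gt0 phi hx (xs s).
Proof.
move=> Es leN; apply: eq_falsified => v ltv.
have ltc : v %/ W < size s by rewrite Es ltn_divLR ?W_gt0 //; apply: leq_trans leN.
by rewrite /pval (onth_nth (dsym (od 0))) ?size_map // (nth_map (od 0)).
Qed.

(** The formula is evaluated only if one type is [Hu] and the other [Hv]. For all other pairs [bad]
    is set, so that [~~ get_bad f] adds nothing to the disjunction. *)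
Definition adjp (hx hy : header) : prog :=
  pseq (if isUV hx hy then falsp tY (dval hy)
        else if isUV hy hx then falsp tX (dval hx)
        else setr (fun f _ => set_bad f true))
  (pseq (scanp (if hx == hy then fun a b => a != b else local hx hy))
  (pseq (emitp (fun f => if hx == hy then get_aux f
                         else [|| base hx hy, ~~ get_bad f | get_aux f]))
        (setr (fun f _ => set_bad (clean f) false)))).

(** * Writing the instance *)

Section Generate.
Variables (N l : nat) (phi : formula N) (q : state M).
Hypothesis N_le : N <= l * W.
Local Notation inp := (zt (map bsym (unary N)) (map bsym (body phi))).
Local Notation fals_cost := (size (encode_formula phi) * (2 * l + 25) + 10).
Local Notation adj_cost := (fals_cost + 8 * l + 20).

Lemma exec_adj hx hy (s1 s2 : seq 'I_b) ta mo out : size s1 = l -> size s2 = l ->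
  exec (adjp hx hy) (rg q mo, cfg inp (dtape s1) (dtape s2) ta (gen out)) adj_cost
    (rg q mo, cfg inp (dtape s1) (dtape s2) ta
       (gen (out ++ [:: vadj l d_gt0 phi hx (xs s1) hy (xs s2)]))).
Proof.
move=> E1 E2; set tp := cfg _ _ _ _ _.
pose bd := if isUV hx hy then bad d_gt0 phi hy (xs s2)
           else if isUV hy hx then bad d_gt0 phi hx (xs s1) else true.
have H1 : exec (if isUV hx hy then falsp tY (dval hy)
        else if isUV hy hx then falsp tX (dval hx)
        else setr (fun f _ => set_bad f true)) (rg q mo, tp) fals_cost (set_bad (rg q mo) bd, tp).
  have fc s : size s = l -> size (encode_formula phi) * (2 * size (map dsym s) + 20 + 5) + 10 <= fals_cost.
    by move=> Es; rewrite size_map Es -addnA.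
  have leN s : size s = l -> N <= size (map dsym s) * W by move=> Es; rewrite size_map Es.
  rewrite /bd; case: ifP => _; last case: ifP => _.
  - apply: (exec_le (fc s2 E2)).
    have := @exec_fals tY (dval hy) isT N _ (leN s2 E2) (rg q mo) tp phi erefl erefl.
    by rewrite (falsified_dval _ _ E2 N_le).
  - apply: (exec_le (fc s1 E1)).
    have := @exec_fals tX (dval hx) isT N _ (leN s1 E1) (rg q mo) tp phi erefl erefl.
    by rewrite (falsified_dval _ _ E1 N_le).
  - by apply: exec_le (exec_setr _ _ _); rewrite addnC.
have H2 := exec_scan (if hx == hy then fun a b => a != b else local hx hy) (set_bad (rg q mo) bd) inp ta (gen out) E1 E2.
set f2 := set_aux _ _ in H2.
have H3 := exec_emit (fun f => if hx == hy then get_aux f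
  else [|| base hx hy, ~~ get_bad f | get_aux f]) f2 inp (dtape s1) (dtape s2) ta out.
set tp3 := cfg _ _ _ _ (gen (rcons _ _)) in H3.
have H4 := @exec_setr F A JJ (fun f _ => set_bad (clean f) false) f2 tp3.
have Ev : (if hx == hy then get_aux f2 else [|| base hx hy, ~~ get_bad f2 | get_aux f2]) =
    vadj l d_gt0 phi hx (xs s1) hy (xs s2).
  rewrite /vadj /f2 get_set_aux; case: (hx == hy) => //=; congr (_ || _).
  rewrite orbA; congr (_ || _); rewrite /get_bad /= /bd.
  by case: (hx); case: (hy) => //= *; rewrite ?orbF.
rewrite /tp3 Ev in H3 H4; rewrite cats1.
by apply: exec_le (exec_seq H1 (exec_seq H2 (exec_seq H3 H4))); lia.
Qed.

Variables (K : nat) (ta : ctape A).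
Local Notation Hs := (enum {: header}).
Local Notation str i := (xs (digs l i)).
Local Notation emits s1 s2 := (does (fun _ : seq bool => True) q (fun out => cfg inp (dtape s1) (dtape s2) ta (gen out))).

Lemma foldl_cat_flatten (I T : Type) (row : I -> seq T) out (hs : seq I) :
  foldl (fun x h => x ++ row h) out hs = out ++ flatten (map row hs).
Proof. by elim: hs out => [|h hs IH] out /=; rewrite ?cats0 // IH catA. Qed.

Lemma emits_bit s1 s2 x : emits s1 s2 (emitp (fun _ => x)) 1 (fun out => out ++ [:: x]).
Proof.
move=> mo out _; split=> //; exists mo; rewrite cats1.
exact: (exec_emit (fun _ => x) (rg q mo)).
Qed.

Lemma emits_adj hx hy s1 s2 : size s1 = l -> size s2 = l ->
  emits s1 s2 (adjp hx hy) adj_cost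
    (fun out => out ++ [:: vadj l d_gt0 phi hx (xs s1) hy (xs s2)]).
Proof. by move=> E1 E2 mo out _; split=> //; exists mo; apply: exec_adj. Qed.

Definition countp : prog := for_strings tX (pseqs [seq emitp (fun _ => true) | h <- Hs]).

Definition matrixp : prog :=
  for_strings tX (pseqs [seq for_strings tY (pseqs [seq adjp hx hy | hy <- Hs]) | hx <- Hs]).

Definition genp : prog :=
  pseq countp (pseq (emitp (fun _ => false))
  (pseq (pseqs [seq emitp (fun _ => true) | h <- iota 0 K])
  (pseq (emitp (fun _ => false)) matrixp))).

Definition matrix_word : seq bool :=
  flatten [seq flatten [seq flatten [seq [seq vadj l d_gt0 phi hx (str i) hy (str j)
    | hy <- Hs] | j <- iota 0 (b ^ l)] | hx <- Hs] | i <- iota 0 (b ^ l)].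

Definition nH := size Hs.
Definition count_cost := b ^ l * ((nH * 1).+1 + 4 * l + 11) + 2.
Definition row_cost := b ^ l * ((nH * adj_cost).+1 + 4 * l + 11) + 2.
Definition matrix_cost := b ^ l * ((nH * row_cost).+1 + 4 * l + 11) + 2.
Definition gen_cost := count_cost + (1 + ((K * 1).+1 + (1 + matrix_cost))).

Lemma foldl_true (I : Type) (hs : seq I) out :
  foldl (fun x _ => x ++ [:: true]) out hs = out ++ nseq (size hs) true.
Proof.
by elim: hs out => [|h hs IH] out /=; rewrite ?cats0 // IH -catA.
Qed.

Lemma emits_count : emits (digs l 0) (digs l 0) countp count_cost
  (fun out => out ++ nseq (b ^ l * nH) true).
Proof.
have := @does_forX _ (fun _ : seq bool => True) q l inp (dtape [::]) (dtape (digs l 0)) (fun _ => ta) gen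
  (pseqs [seq emitp (fun _ => true) | h <- Hs]) (nH * 1).+1
  (fun _ out => foldl (fun x _ => x ++ [:: true]) out Hs).
have -> : (fun x => foldl (fun x0 (_ : nat) => foldl (fun x1 _ => x1 ++ [:: true]) x0 Hs) x (iota 0 (b ^ l)))
  = (fun out => out ++ nseq (b ^ l * nH) true).
  apply: funext => out; rewrite -{2}(size_iota 0 (b ^ l)).
  elim: (iota _ _) out => [|i r IH] out /=; first by rewrite cats0.
  by rewrite IH foldl_true -catA -nseqD mulSn.
apply=> i lti; apply: (does_pseqs (bd := fun _ => emitp (fun _ => true))
  (g := fun _ out => out ++ [:: true])) => h.
exact: emits_bit.
Qed.

Lemma emits_matrix : emits (digs l 0) (digs l 0) matrixp matrix_cost
  (fun out => out ++ matrix_word).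
Proof.
have := @does_forX _ (fun _ : seq bool => True) q l inp (dtape [::]) (dtape (digs l 0)) (fun _ => ta) gen
  (pseqs [seq for_strings tY (pseqs [seq adjp hx hy | hy <- Hs]) | hx <- Hs]) (nH * row_cost).+1
  (fun i out => foldl (fun x hx => x ++ flatten [seq [seq vadj l d_gt0 phi hx (str i) hy (str j)
    | hy <- Hs] | j <- iota 0 (b ^ l)]) out Hs).
have -> : (fun x => foldl (fun x0 i => foldl (fun x hx => x ++ flatten [seq [seq vadj l d_gt0 phi hx (str i) hy (str j)
    | hy <- Hs] | j <- iota 0 (b ^ l)]) x0 Hs) x (iota 0 (b ^ l))) = (fun out => out ++ matrix_word).
  apply: funext => out; rewrite /matrix_word -foldl_cat_flatten; congr (foldl _ _ _).
  by apply: funext => x0; apply: funext => i; apply: foldl_cat_flatten.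
apply=> i lti.
apply: (does_pseqs (bd := fun hx => for_strings tY (pseqs [seq adjp hx hy | hy <- Hs]))
  (g := fun hx out => out ++ flatten [seq [seq vadj l d_gt0 phi hx (str i) hy (str j)
    | hy <- Hs] | j <- iota 0 (b ^ l)])) => hx.
have := @does_forY _ (fun _ : seq bool => True) q l inp (dtape (digs l i)) (dtape [::]) (fun _ => ta) gen
  (pseqs [seq adjp hx hy | hy <- Hs]) (nH * adj_cost).+1
  (fun j out => foldl (fun x hy => x ++ [:: vadj l d_gt0 phi hx (str i) hy (str j)]) out Hs).
have -> : (fun x => foldl (fun x0 j => foldl (fun x hy => x ++ [:: vadj l d_gt0 phi hx (str i) hy (str j)]) x0 Hs) x (iota 0 (b ^ l)))
   = (fun out => out ++ flatten [seq [seq vadj l d_gt0 phi hx (str i) hy (str j)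
    | hy <- Hs] | j <- iota 0 (b ^ l)]).
  apply: funext => out; rewrite -foldl_cat_flatten; congr (foldl _ _ _).
  apply: funext => x0; apply: funext => j; rewrite foldl_cat_flatten; congr (_ ++ _).
  by elim: (Hs) => //= h hs ->.
apply=> j ltj; apply: (does_pseqs (bd := adjp hx)
  (g := fun hy out => out ++ [:: vadj l d_gt0 phi hx (str i) hy (str j)])) => hy.
by apply: emits_adj; rewrite size_digs.
Qed.

Lemma exec_gen mo : exists mo',
  exec genp (rg q mo, cfg inp (dtape (digs l 0)) (dtape (digs l 0)) ta (gen [::])) gen_cost
   (rg q mo', cfg inp (dtape (digs l 0)) (dtape (digs l 0)) ta
     (gen (unary (b ^ l * nH) ++ unary K ++ matrix_word))).
Proof.
have EK := does_pseqs (bd := fun _ : nat => emitp (fun _ => true))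
  (g := fun _ out => out ++ [:: true]) (iota 0 K) (fun _ => emits_bit (digs l 0) (digs l 0) true).
rewrite size_iota in EK.
have := does_seq emits_count (does_seq (emits_bit _ _ false)
  (does_seq EK (does_seq (emits_bit _ _ false) emits_matrix))).
move=> /(_ mo [::] I) [_ [mo' H]]; exists mo'.
by move: H; rewrite foldl_true size_iota /= /unary -!cats1 -!catA.
Qed.
End Generate.

(** * Simulation of the approximation machine *)

Definition get_q f : state M := f.1.1.1.1.
Definition set_q f q : F := let: (_, c, x, y, z) := f in (q, c, x, y, z).
Definition bit_of (o : option A) : symbol := if o is Some (inl x) then Some x else None.

Definition sim_step : prog :=
  act (fun f sc =>
    let r := trans (get_q f) [ffun i => bit_of (sc (tM i))] in
    (set_q f r.1, fun j => if j is Some (Some (Some (Some i)))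
                           then (omap bsym (r.2 i).1, (r.2 i).2) else (sc j, Stay))).

Definition simp : prog := loop (fun f _ => ~~ halting (get_q f)) sim_step.

Definition mrep (mt : 'I_(extra_tapes M).+1 -> ctape A) (c : config M) : Prop :=
  forall i, rep (fun s a => a = omap bsym s) (ctapes c i) (mt i).

Lemma iter_step_halting (c : config M) k : halting (cstate c) -> iter k (@step M) c = c.
Proof. by move=> H; elim: k => //= k ->; rewrite /step H. Qed.

Lemma exec_sim ti tx ty ta k (c : config M) mo mt :
  halting (cstate (iter k (@step M) c)) -> mrep mt c -> exists mt',
    mrep mt' (iter k (@step M) c) /\
    exec simp (rg (cstate c) mo, cfg ti tx ty ta mt) (2 * k + 1)
      (rg (cstate (iter k (@step M) c)) mo, cfg ti tx ty ta mt').
Proof.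
elim: k c mt => [|k IH] c mt Hh Hm.
  by exists mt; split=> //; apply: exec_loop0; rewrite /= Hh.
case Hc: (halting (cstate c)).
  exists mt; rewrite iter_step_halting //; split=> //.
  by apply: exec_le (exec_loop0 _ _); [lia | rewrite /= Hc].
rewrite iterSr in Hh *.
have Es : [ffun i => bit_of (rd (mt i))] = [ffun i => scanned (ctapes c i)].
  by apply/ffunP => i; rewrite !ffunE /rd; case: (Hm i) => -> _ _; case: (ctapes c i) => [[? []]].
set r := trans (cstate c) [ffun i => scanned (ctapes c i)].
pose mt1 i := wm (omap bsym (r.2 i).1, (r.2 i).2) (mt i).
have Ec : step c = Config r.1 (fun i => write_move (r.2 i) (ctapes c i)).
  by rewrite /step Hc /r; case: trans.
have Hm1 : mrep mt1 (step c).
  rewrite Ec /mt1 => i /=; case: (r.2 i) => a dd /=.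
  exact: (@rep_move _ (fun s a => a = omap bsym s)).
have [mt' [Hm' H']] := IH (step c) mt1 Hh Hm1.
exists mt'; split=> //.
have H1 := @exec_act F A JJ (fun f sc =>
    let r := trans (get_q f) [ffun i => bit_of (sc (tM i))] in
    (set_q f r.1, fun j => if j is Some (Some (Some (Some i)))
                           then (omap bsym (r.2 i).1, (r.2 i).2) else (sc j, Stay)))
   (rg (cstate c) mo) (cfg ti tx ty ta mt).
rewrite /= Es -/r in H1.
have E1 : (fun j => wm (if j is Some (Some (Some (Some i)))
      then (omap bsym (r.2 i).1, (r.2 i).2) else (rd (cfg ti tx ty ta mt j), Stay))
      (cfg ti tx ty ta mt j)) = cfg ti tx ty ta mt1.
  by apply: funext => -[[[[i|]|]|]|] //=; rewrite wm_stay.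
rewrite E1 in H1.
have E2 : cstate (step c) = r.1 by rewrite Ec.
rewrite E2 in H'.
by apply: exec_le (exec_loopS _ H1 H'); [lia | rewrite /= Hc].
Qed.

Lemma mrep_init (y : seq bool) :
  mrep (upd (gen y) ord0 (zt [::] (map bsym y))) (init_config M y).
Proof.
move=> i; rewrite /= /upd /gen; case: eqP => _; last first.
  by split=> //= j; rewrite nth_nil // /word_content /=; case: (_ - _)%R => //; case.
split=> /=.
- by case: y.
- move=> j; rewrite nth_nil /zt /=.
  by have -> : (0 - 1 - Posz j = Negz j)%R by lia.
- move=> j; rewrite /zt /= add0n.
  by case: y => [|x y] /=; [rewrite nth_nil | elim: y j => [|z y IH] [|j] //=].
Qed.

(** A vertex of type [Hu h] in the answer overwrites the segment of its cell. For a large minimal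
    dominating set the order of overwriting is immaterial, since members of one cell carry equal
    strings by [upper_cell_inj]. *)
Definition acc_upd (h : 'I_t) (x : digit) (a : accd) : accd :=
  [ffun r : 'I_W => if r %/ d == h then col1 x (row_of d_gt0 r) else a r].

Definition acc_sym (h : 'I_t) (ox oa : option A) : option A :=
  if oa is Some (inr (inr a)) then Some (asym (acc_upd h (dig_of ox) a)) else oa.

Definition copys (h : 'I_t) (s : seq 'I_b) (accs : seq accd) : seq accd :=
  [seq acc_upd h (enum_val xa.1) xa.2 | xa <- zip s accs].

Definition copy_step (h : 'I_t) : prog :=
  pseq (write tA (fun _ sc => acc_sym h (sc tX) (sc tA)) MoveRight) (move tX MoveRight).

Definition copyp (h : 'I_t) : prog :=
  pseq (loop (nonblank tX) (copy_step h)) (pseq (rewind F A tX) (rewind F A tA)).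

Definition atape (accs : seq accd) : ctape A := zt [::] (map asym accs).

Lemma exec_copy_loop h f ti ty mt pre1 pre2 (s : seq 'I_b) (accs : seq accd) :
  size s = size accs ->
  exec (loop (nonblank tX) (copy_step h))
    (f, cfg ti (zt pre1 (map dsym s)) ty (zt pre2 (map asym accs)) mt) (3 * size s + 1)
    (f, cfg ti (zt (pre1 ++ map dsym s) [::]) ty (zt (pre2 ++ map asym (copys h s accs)) [::]) mt).
Proof.
elim: s accs pre1 pre2 => [|x s IH] [|a accs] pre1 pre2 //= Es.
  by rewrite !cats0; apply: exec_loop0; rewrite /nonblank /= rd_zt.
set tp := cfg _ _ _ _ _.
have H1 : exec (copy_step h) (f, tp) 2
    (f, cfg ti (zt (rcons pre1 (dsym x)) (map dsym s)) ty
         (zt (rcons pre2 (asym (acc_upd h (enum_val x) a))) (map asym accs)) mt).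
  have T1 := @exec_write_right F A JJ tA (fun _ sc => acc_sym h (sc tX) (sc tA)) f tp pre2 (map asym (a :: accs))
    (asym (acc_upd h (enum_val x) a)) erefl.
  rewrite /tp /= !rd_zt /= cfgA in T1.
  set tp2 := cfg _ _ _ (zt (rcons _ _) _) _ in T1.
  have T2 := @exec_right F A JJ tX f tp2 _ _ _ erefl.
  rewrite cfgX in T2; exact: exec_seq (T1 erefl) T2.
have := IH accs (rcons pre1 (dsym x)) (rcons pre2 (asym (acc_upd h (enum_val x) a))) (succn_inj Es).
rewrite !cat_rcons => H2.
apply: exec_le (exec_loopS _ H1 H2); first by lia.
by rewrite /nonblank /tp /= rd_zt.
Qed.

Lemma size_copys h s accs : size s = size accs -> size (copys h s accs) = size accs.
Proof. by move=> E; rewrite size_map size_zip E minnn. Qed.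

Lemma exec_copy h f ti ty mt (s : seq 'I_b) (accs : seq accd) l :
  size s = l -> size accs = l ->
  exec (copyp h) (f, cfg ti (dtape s) ty (atape accs) mt) (7 * l + 11)
    (f, cfg ti (dtape s) ty (atape (copys h s accs)) mt).
Proof.
move=> E1 E2; have E12 : size s = size accs by rewrite E1.
have := exec_copy_loop h f ti ty mt [::] [::] E12.
rewrite /=; set tp1 := (X in exec _ _ _ (_, X)) => H1.
have H2 := @exec_rewind F A JJ tX f tp1 _ _ erefl.
rewrite cfgX cats0 in H2; set tp2 := cfg _ _ _ _ _ in H2.
have H3 := @exec_rewind F A JJ tA f tp2 _ _ erefl.
rewrite cfgA cats0 in H3.
apply: exec_le (exec_seq H1 (exec_seq H2 H3)).
by rewrite !size_map size_zip E1 E2 minnn; lia.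
Qed.

Definition out_bit (f : F) (sc : JJ -> option A) : bool := sc (tM ord0) == Some (bsym true).

Definition decp (hx : header) : prog :=
  pseq (ite out_bit (if hx is Hu h then copyp h else skip F A JJ) (skip F A JJ))
       (move (tM ord0) MoveRight).

Definition decodep : prog := for_strings tX (pseqs [seq decp hx | hx <- enum {: header}]).

Section Decode.
Variables (l : nat) (bit : nat -> bool).

(* The second component counts the bits of the answer of [M] already read. *)
Definition vstep (i : nat) (hx : header) (x : seq accd * nat) : seq accd * nat :=
  (if bit x.2 then (if hx is Hu h then copys h (digs l i) x.1 else x.1) else x.1, x.2.+1).

Definition decode_from (x : seq accd * nat) :=
  foldl (fun x i => foldl (fun x hx => vstep i hx x) x (enum {: header})) x (iota 0 (b ^ l)).

Definition decode_cost := b ^ l * ((nH * (7 * l + 13)).+1 + 4 * l + 11) + 2.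

(** The answer enters through the cells right of the head and not as a word of the correct length,
    so the run is under control whatever [M] has written. *)
Lemma exec_decode q mo ti ty mt c h accs :
  (forall k : nat, bit k = (c (h + Posz k)%R == Some (bsym true))) ->
  size accs = l -> mt ord0 = (c, h) ->
  size (decode_from (accs, 0)).1 = l /\ exists mo' mt',
  exec decodep (rg q mo, cfg ti (dtape (digs l 0)) ty (atape accs) mt) decode_cost
    (rg q mo', cfg ti (dtape (digs l 0)) ty (atape (decode_from (accs, 0)).1) mt').
Proof.
move=> Hbit Eaccs Emt.
pose mts (x : seq accd * nat) := upd mt ord0 (c, h + Posz x.2)%R.
pose P (x : seq accd * nat) := size x.1 = l.
have Hstep i hx : does P q (fun x => cfg ti (dtape (digs l i)) ty (atape x.1) (mts x))
   (decp hx) (7 * l + 13) (vstep i hx).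
  move=> mo1 [a k] Pa; rewrite /P /= in Pa; split.
    rewrite /P /vstep /=; case: (bit k) => //; case: (hx) => // h0.
    by rewrite size_copys ?size_digs.
  exists mo1; set tp := cfg _ _ _ _ _.
  have Eb : out_bit (rg q mo1) (fun j => rd (tp j)) = bit k.
    by rewrite Hbit /out_bit /tp /= /mts upd_get.
  have H1 : exec (ite out_bit (if hx is Hu h then copyp h else skip F A JJ) (skip F A JJ))
     (rg q mo1, tp) (7 * l + 12)
     (rg q mo1, cfg ti (dtape (digs l i)) ty (atape (vstep i hx (a, k)).1) (mts (a, k))).
    have -> : 7 * l + 12 = (7 * l + 11).+1 by lia.
    apply: exec_ite; rewrite Eb /vstep /=; case: (bit k); last first.
      by apply: exec_le (exec_skip _); lia.
    case: (hx) => [||?|?|h0|? ? ?]; try by apply: exec_le (exec_skip _); lia.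
    by apply: exec_le (exec_copy _ _ _ _ _ (size_digs _ _ _) Pa); lia.
  set tp1 := cfg _ _ _ _ _ in H1.
  have E1 : tp1 (tM ord0) = (c, h + Posz k)%R by rewrite /tp1 /= /mts upd_get.
  have H2 := @exec_move F A JJ (tM ord0) MoveRight (rg q mo1) tp1 _ _ E1.
  rewrite cfgM /mts upd_upd /= in H2.
  have Ek : (h + Posz k + 1 = h + Posz k.+1)%R by lia.
  rewrite Ek in H2.
  by apply: exec_le (exec_seq H1 H2); lia.
have := @does_forX _ P q l ti (dtape [::]) ty (fun x => atape x.1) mts
  (pseqs [seq decp hx | hx <- enum {: header}]) (nH * (7 * l + 13)).+1
  (fun i x => foldl (fun x hx => vstep i hx x) x (enum {: header})).
move=> /(_ (fun i _ => does_pseqs (bd := decp) (g := vstep i) _ (Hstep i))) /(_ mo (accs, 0) Eaccs).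
case=> Ps [mo' H]; split=> //; exists mo', (mts (decode_from (accs, 0))).
move: H; rewrite {1}/mts /= addr0 -Emt upd_id; exact.
Qed.

End Decode.

(** * Initialisation, final evaluation and the whole program *)

Definition ncols (N : nat) : nat := (N + W.-1) %/ W.

Lemma ncols_ge N : N <= ncols N * W.
Proof.
have := ltn_ceil (N + W.-1) W_gt0; rewrite -/(ncols N) mulSn.
by have := W_gt0; move: (ncols N * W) W => i j; lia.
Qed.

Lemma ncols_le N : ncols N * W <= N + W.
Proof.
have := leq_trunc_div (N + W.-1) W; rewrite -/(ncols N).
by have := W_gt0; move: (ncols N * W) W => i j; lia.
Qed.

(** While the unary number of variables is read, a new column starts exactly when the counter modulo
    [W] is 0; this is the test made by [init_step]. *)
Lemma ncolsS i : ncols i.+1 = if i %% W == 0 then (ncols i).+1 else ncols i.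
Proof.
have W0 := W_gt0.
have -> : ncols i.+1 = (i %/ W).+1.
  by rewrite /ncols addSnnS prednK // divnDr ?dvdnn // divnn W0 addn1.
have Ei : i + W.-1 = i %/ W * W + (i %% W + W.-1) by rewrite addnA -divn_eq.
rewrite /ncols Ei divnMDl //.
have ltm := ltn_pmod i W0.
case: eqP => [->|ne].
  have lt0 : W.-1 < W by rewrite ltn_predL.
  by rewrite add0n (divn_small lt0) addn0.
have E1 : i %% W + W.-1 = 1 * W + (i %% W).-1.
  by move: W0 ne; move: (i %% W) W => m n; lia.
have lt1 : (i %% W).-1 < W by apply: leq_ltn_trans ltm; apply: leq_pred.
by rewrite E1 divnMDl // (divn_small lt1) addn0 addn1.
Qed.

Lemma digs0 l : digs l 0 = nseq l (od 0).
Proof. by elim: l => //= l IH; rewrite div0n IH. Qed.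

Definition acc0 : accd := [ffun=> false].

Definition init_step : prog :=
  pseq (ite (fun f _ => val (get_cnt f) == 0)
     (pseq (write tX (fun _ _ => Some (dsym (od 0))) MoveRight)
     (pseq (write tY (fun _ _ => Some (dsym (od 0))) MoveRight)
           (write tA (fun _ _ => Some (asym acc0)) MoveRight)))
     (skip F A JJ))
  (pseq (move tI MoveRight) (setr (fun f _ => set_cnt f (ordS (get_cnt f))))).

Definition initp : prog :=
  pseq (loop at_true init_step) (pseq (move tI MoveRight) (pseq (setr (fun f _ => clean f))
    (pseq (rewind F A tX) (pseq (rewind F A tY) (rewind F A tA))))).

Lemma exec_init q mo mt N (y : seq bool) :
  exec initp (rg q mo, cfg (zt [::] (map bsym (unary N ++ y))) (zt [::] [::]) (zt [::] [::]) (zt [::] [::]) mt)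
    (7 * N + 6 * ncols N + 20)
    (rg q mo, cfg (zt (map bsym (unary N)) (map bsym y)) (dtape (digs (ncols N) 0))
       (dtape (digs (ncols N) 0)) (atape (nseq (ncols N) acc0)) mt).
Proof.
pose dt i : ctape A := zt (nseq (ncols i) (dsym (od 0))) [::].
pose at' i : ctape A := zt (nseq (ncols i) (asym acc0)) [::].
pose ms i := (set_cnt (rg q mo) (cO i),
  cfg (zt (nseq i (bsym true)) (nseq (N - i) (bsym true) ++ bsym false :: map bsym y))
    (dt i) (dt i) (at' i) mt) : mem F A JJ.
have rc (T : Type) n (x : T) : rcons (nseq n x) x = nseq n.+1 x.
  by rewrite -cats1 -(nseqD _ 1) addn1.
have nc0 : ncols 0 = 0 by rewrite /ncols divn_small // add0n ltn_predL W_gt0.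
have E0 : (rg q mo, cfg (zt [::] (map bsym (unary N ++ y))) (zt [::] [::]) (zt [::] [::]) (zt [::] [::]) mt) = ms 0.
  rewrite /ms /dt /at' nc0 subn0 map_unary; congr pair.
  by rewrite /rg /set_cnt; congr (_, _, _, _, _); apply: val_inj; rewrite /= mod0n.
have H1 : exec (loop at_true init_step) (ms 0) (N * 7).+1 (ms N).
  apply: exec_loop; last by rewrite /at_true /ms /= rd_zt subnn.
  move=> i lti; split; first by rewrite /at_true /ms /= rd_zt -(subnSK lti).
  pose f1 := set_cnt (rg q mo) (cO i).
  pose ti1 := zt (nseq i (bsym true)) (bsym true :: nseq (N - i.+1) (bsym true) ++ bsym false :: map bsym y).
  have T1 : exec (ite (fun f _ => val (get_cnt f) == 0)
     (pseq (write tX (fun _ _ => Some (dsym (od 0))) MoveRight)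
     (pseq (write tY (fun _ _ => Some (dsym (od 0))) MoveRight)
           (write tA (fun _ _ => Some (asym acc0)) MoveRight)))
     (skip F A JJ)) (ms i) 4 (f1, cfg ti1 (dt i.+1) (dt i.+1) (at' i.+1) mt).
    rewrite /ms -(subnSK lti) -/f1 -[zt _ _]/ti1.
    apply: exec_ite; rewrite /dt /at' ncolsS -[val (get_cnt f1)]/(i %% W).
    case: ifP => _; last by apply: exec_le (exec_skip _).
    have S1 := @exec_write_right F A JJ tX (fun _ _ => Some (dsym (od 0))) f1
      (cfg ti1 (dt i) (dt i) (at' i) mt) _ _ _ erefl erefl.
    rewrite cfgX rc in S1; set tp1 := cfg _ (zt _ (behead _)) _ _ _ in S1.
    have S2 := @exec_write_right F A JJ tY (fun _ _ => Some (dsym (od 0))) f1 tp1 _ _ _ erefl erefl.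
    rewrite cfgY rc in S2; set tp2 := cfg _ _ (zt _ (behead _)) _ _ in S2.
    have S3 := @exec_write_right F A JJ tA (fun _ _ => Some (asym acc0)) f1 tp2 _ _ _ erefl erefl.
    rewrite cfgA rc in S3.
    exact: exec_seq S1 (exec_seq S2 S3).
  set tp1 := cfg _ _ _ _ _ in T1.
  have T2 := @exec_right F A JJ tI f1 tp1 _ _ _ erefl.
  rewrite cfgI rc in T2; set tp2 := cfg _ _ _ _ _ in T2.
  have T3 := @exec_setr F A JJ (fun f _ => set_cnt f (ordS (get_cnt f))) f1 tp2.
  rewrite -[set_cnt _ _]/(set_cnt (rg q mo) (ordS (cO i))) ordS_cO in T3.
  exact: exec_seq T1 (exec_seq T2 T3).
rewrite E0.
have H2 := @exec_right F A JJ tI (ms N).1 (ms N).2 (nseq N (bsym true)) (bsym false) (map bsym y).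
have EN : (ms N).2 tI = zt (nseq N (bsym true)) (bsym false :: map bsym y) by rewrite /ms /= subnn.
have {}H2 := H2 EN; rewrite cfgI in H2; set tp2 := cfg _ _ _ _ _ in H2.
have H3 := @exec_setr F A JJ (fun f _ => clean f) (ms N).1 tp2.
rewrite -[clean _]/(rg q mo) in H3.
have H4 := @exec_rewind F A JJ tX (rg q mo) tp2 _ _ erefl.
rewrite cfgX cats0 in H4; set tp4 := cfg _ _ _ _ _ in H4.
have H5 := @exec_rewind F A JJ tY (rg q mo) tp4 _ _ erefl.
rewrite cfgY cats0 in H5; set tp5 := cfg _ _ _ _ _ in H5.
have H6 := @exec_rewind F A JJ tA (rg q mo) tp5 _ _ erefl.
rewrite cfgA cats0 in H6.
rewrite /dtape /atape digs0 !map_nseq /unary map_rcons map_nseq.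
rewrite [ms N]surjective_pairing in H1.
apply: exec_le (exec_seq H1 (exec_seq H2 (exec_seq H3 (exec_seq H4 (exec_seq H5 H6))))).
by rewrite !size_nseq; lia.
Qed.

Definition aval (o : option A) (r : nat) : option bool :=
  if o is Some (inr (inr a)) then Some (a (cO r)) else None.

Definition acc_val (accs : seq accd) (v : nat) : bool := nth acc0 accs (v %/ W) (cO v).

Lemma falsified_aval N (phi : formula N) accs l : size accs = l -> N <= l * W ->
  falsified (pval aval (map asym accs)) phi = falsified (fun v => Some (acc_val accs v)) phi.
Proof.
move=> Es leN; apply: eq_falsified => v ltv.
have ltc : v %/ W < size accs by rewrite Es ltn_divLR ?W_gt0 //; apply: leq_trans leN.
rewrite /pval (onth_nth (asym acc0)) ?size_map // (nth_map acc0) //= /acc_val.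
by have -> : cO (v %% W) = cO v by apply: val_inj; rewrite /= modn_mod.
Qed.

Lemma exec_loop_right w f tp pre rest : tp w = zt pre rest ->
  exec (loop (nonblank w) (move w MoveRight)) (f, tp) (2 * size rest + 1)
    (f, upd tp w (zt (pre ++ rest) [::])).
Proof.
elim: rest pre tp => [|a rest IH] pre tp E.
  by rewrite cats0 -E upd_id; apply: exec_loop0; rewrite /nonblank E rd_zt.
have H1 := @exec_right F A JJ w f tp _ _ _ E.
have H2 := IH _ (upd tp w (zt (rcons pre a) rest)) (upd_get _ _ _).
rewrite upd_upd cat_rcons in H2.
apply: exec_le (exec_loopS _ H1 H2); first by rewrite /=; lia.
by rewrite /nonblank E rd_zt.
Qed.

Definition finishp : prog :=
  pseq (falsp tA aval)
  (pseq (loop (nonblank tI) (move tI MoveRight))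
        (write tI (fun f _ => Some (bsym (~~ get_bad f))) Stay)).

Lemma exec_finish q mo N (phi : formula N) l tx ty accs mt :
  size accs = l -> N <= l * W -> exists f tp,
  exec finishp (rg q mo, cfg (zt (map bsym (unary N)) (map bsym (body phi))) tx ty (atape accs) mt)
    (size (encode_formula phi) * (2 * l + 27) + 20) (f, tp) /\
  tp None = (fun z => if z == Posz (size (encode_formula phi))
      then Some (inl (~~ falsified (fun v => Some (acc_val accs v)) phi))
      else word_content (map inl (encode_formula phi)) z, Posz (size (encode_formula phi))).
Proof.
move=> Es leN; set tp := cfg _ _ _ _ _.
have leN' : N <= size (map asym accs) * W by rewrite size_map Es.
have H1 := @exec_fals tA aval isT N _ leN' (rg q mo) tp phi erefl erefl.
rewrite (falsified_aval _ Es leN) in H1; set f1 := set_bad _ _ in H1.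
have H2 := @exec_loop_right tI f1 tp _ _ erefl.
rewrite cfgI -map_cat in H2; set tp2 := cfg _ _ _ _ _ in H2.
have E2 : tp2 tI = (word_content (map bsym (encode_formula phi)), Posz (size (encode_formula phi))).
  by rewrite /tp2 /= /zt cats0 size_map.
have H3 := @exec_write F A JJ tI (fun f _ => Some (bsym (~~ get_bad f))) Stay f1 tp2 _ _ E2.
exists f1; eexists; split.
  apply: exec_le (exec_seq H1 (exec_seq H2 H3)).
  rewrite !size_map Es.
  have : size (body phi) <= size (encode_formula phi).
    by rewrite /encode_formula size_cat leq_addl.
  by move: (size (body phi)) (size _) => i j; nia.
by rewrite upd_get /= addr0.
Qed.

Definition mainp K : prog :=
  pseq initp (pseq (genp K) (pseq (rewind F A (tM ord0)) (pseq simp (pseq decodep finishp)))).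

Definition instance_word N (phi : formula N) K :=
  unary (b ^ ncols N * nH) ++ unary K ++ matrix_word (ncols N) phi.

Definition main_cost N (phi : formula N) K k :=
  (7 * N + 6 * ncols N + 20) + (gen_cost (ncols N) phi K +
  ((2 * size (instance_word phi K) + 5) + ((2 * k + 1) + (decode_cost (ncols N) +
  (size (encode_formula phi) * (2 * ncols N + 27) + 20))))).

Lemma input_tapesE (w : seq bool) :
  @input_tapes _ tape_name w = cfg (zt [::] (map bsym w)) (zt [::] [::]) (zt [::] [::]) (zt [::] [::]) (gen [::]).
Proof.
have E : (fun=> None, 0%R) = zt [::] [::] :> ctape A.
  by rewrite /zt /=; congr pair; apply: funext => -[[|i]|i].
apply: funext => -[[[[i|]|]|]|]; rewrite /input_tapes /cfg /gen ?E //.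
by case: ifP.
Qed.

Lemma read_bits_nth (s : seq symbol) k : k < size (read_bits s) ->
  nth None s k = Some (nth false (read_bits s) k).
Proof. by elim: s k => [|[x|] s IH] [|k] //= /IH. Qed.

(** The bits used for decoding are tied to the result of [M] only as far as this word reaches; this
    suffices, as a correct answer has one bit per vertex. *)
Lemma exec_main K N (phi : formula N) k :
  halts_within M (instance_word phi K) k ->
  exists f tp bit, [/\ exec (mainp K) (rg (start M) false, @input_tapes _ tape_name (encode_formula phi))
      (main_cost phi K k) (f, tp),
    forall i, i < size (result (run M (instance_word phi K) k)) ->
      bit i = nth false (result (run M (instance_word phi K) k)) i &
    tp None = (fun z => if z == Posz (size (encode_formula phi))
      then Some (inl (~~ falsified (fun v => Some (acc_val
         (decode_from (ncols N) bit (nseq (ncols N) acc0, 0)).1 v)) phi))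
      else word_content (map inl (encode_formula phi)) z, Posz (size (encode_formula phi)))].
Proof.
move=> Hk; set l := ncols N; set y := instance_word phi K.
have H1 := exec_init (start M) false (gen [::]) N (body phi).
have [mo2 H2] := @exec_gen N l phi (start M) (ncols_ge N) K (atape (nseq l acc0)) false.
rewrite -[unary _ ++ _]/y in H2; set tp2 := cfg _ _ _ _ (gen y) in H2.
have H3 := @exec_rewind F A JJ (tM ord0) (rg (start M) mo2) tp2 (map bsym y) [::] erefl.
rewrite cats0 cfgM size_map in H3.
have [mt4 [Hm4 H4]] := exec_sim (zt (map bsym (unary N)) (map bsym (body phi)))
  (dtape (digs l 0)) (dtape (digs l 0)) (atape (nseq l acc0)) mo2 Hk (mrep_init y).
case E4: (mt4 ord0) => [c h].
pose bit (i : nat) := c (h + Posz i)%R == Some (bsym true).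
have sa : size (nseq l acc0) = l by rewrite size_nseq.
have [Es [mo5 [mt5 H5]]] := exec_decode (bit := bit) (cstate (run M y k)) mo2 (zt (map bsym (unary N)) (map bsym (body phi))) (dtape (digs l 0)) (fun=> erefl) sa E4.
have [f [tp [H6 E6]]] := exec_finish (cstate (run M y k)) mo5 phi (dtape (digs l 0)) (dtape (digs l 0)) mt5 Es (ncols_ge N).
exists f, tp, bit; split=> //.
  rewrite input_tapesE -[encode_formula phi]/(unary N ++ body phi).
  exact: exec_seq H1 (exec_seq H2 (exec_seq H3 (exec_seq H4 (exec_seq H5 H6)))).
move=> i; rewrite /bit /result; have := Hm4 ord0; rewrite E4 -/(run M y k).
case: (ctapes _ _) => [[l0 a] r] [/= Ha _ Hr] lti.
have := @read_bits_nth (a :: r) i lti.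
case: i {lti} => [|i] /= En.
  by rewrite addr0 Ha En; case: (nth _ _ _).
have -> : (h + Posz i.+1 = h + 1 + Posz i)%R by lia.
by rewrite Hr En; case: (nth _ _ _).
Qed.


(** * Correctness of the 3-SAT machine *)

Section Correct.
Variables (N : nat) (phi : formula N).
Local Notation l := (ncols N).
Local Notation Hs := (enum {: header}).

(** The vertices in the order in which the loops of [matrixp] visit them: by string, and by type
    within a string. *)
Definition vs : seq (nat * header) := [seq (i, hx) | i <- iota 0 (b ^ l), hx <- Hs].
Definition nv := b ^ l * nH.

Lemma size_vs : size vs = nv.
Proof. by rewrite size_allpairs size_iota. Qed.

Lemma uniq_vs : uniq vs.
Proof. by apply: allpairs_uniq; rewrite ?iota_uniq ?enum_uniq // => -[? ?] [? ?]. Qed.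

Definition lab (u : 'I_nv) : nat * header := nth (0, Hz) vs u.
Definition hd (u : 'I_nv) : header := (lab u).2.
Definition st (u : 'I_nv) : nat -> digit := xs (digs l (lab u).1).

Lemma lab_mem u : lab u \in vs.
Proof. by apply: mem_nth; rewrite size_vs. Qed.

Lemma lab_lt u : (lab u).1 < b ^ l.
Proof. by have /allpairsP[[i hx] [Hi _ ->]] := lab_mem u; rewrite mem_iota in Hi. Qed.

Lemma lab_inj u v : hd u = hd v -> (forall c : 'I_l, st u c = st v c) -> u = v.
Proof.
move=> Eh Es; apply: val_inj; apply/eqP.
rewrite -(nth_uniq (0, Hz) _ _ uniq_vs) ?size_vs; [|exact: ltn_ord..]; apply/eqP.
rewrite -/(lab u) -/(lab v) [lab u]surjective_pairing [lab v]surjective_pairing.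
congr pair; last exact: Eh.
apply: (digs_inj (b_gt0 := b_gt0) (lab_lt u) (lab_lt v)).
apply: (@eq_from_nth _ (od 0)); rewrite !size_digs // => i lti.
exact: enum_val_inj (Es (Ordinal lti)).
Qed.

Lemma lab_surj h (x : nat -> digit) :
  exists2 u, hd u = h & forall c : 'I_l, st u c = x c.
Proof.
have [i lti Ei] := digs_surj b_gt0 l (fun c => enum_rank (x c)).
have iv : (i, h) \in vs.
  by apply/allpairsP; exists (i, h); rewrite mem_iota mem_enum.
have ltv : index (i, h) vs < nv by rewrite -size_vs index_mem.
have El : lab (Ordinal ltv) = (i, h) by rewrite /lab nth_index.
exists (Ordinal ltv); first by rewrite /hd El.
by move=> c; rewrite /st El /xs Ei nth_mkseq // enum_rankK.
Qed.

Definition red_graph : graph nv :=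
  @Graph nv (fun u v => vadj l d_gt0 phi (hd u) (st u) (hd v) (st v))
    (fun u v => vadj_sym _ _ _ _ _ _ _) (fun u => vadj_irr _ _ _ _ _).

Lemma red_adjE u v :
  adj red_graph u v = vadj l d_gt0 phi (hd u) (st u) (hd v) (st v).
Proof. by []. Qed.

Lemma map_lab : map lab (enum 'I_nv) = vs.
Proof.
rewrite -[RHS](mkseq_nth (0, Hz)) size_vs /mkseq -val_enum_ord -map_comp.
exact: eq_map.
Qed.

Lemma flatten_map_flatten (T1 T2 : Type) (g : T1 -> seq T2) (L : seq (seq T1)) :
  flatten (map g (flatten L)) = flatten [seq flatten (map g s) | s <- L].
Proof. by elim: L => //= s L IH; rewrite map_cat flatten_cat IH. Qed.

Lemma encode_red K : encode_instance red_graph K = instance_word phi K.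
Proof.
rewrite /encode_instance /instance_word; congr (_ ++ (_ ++ _)).
pose f (x y : nat * header) := vadj l d_gt0 phi x.2 (xs (digs l x.1)) y.2 (xs (digs l y.1)).
transitivity [seq f x y | x <- vs, y <- vs].
  by rewrite -map_lab allpairs_mapl allpairs_mapr.
rewrite /matrix_word {1}/vs flatten_map_flatten -map_comp; congr flatten.
apply: eq_map => i /=; rewrite -map_comp; congr flatten; apply: eq_map => hx /=.
rewrite map_flatten -map_comp; congr flatten.
by apply: eq_map => j /=; rewrite -map_comp.
Qed.

Section DecodeCorrect.
Variables (D : {set 'I_nv}) (bit : nat -> bool).
Hypotheses (uD : upper_dominating red_graph D) (big : 3 * t + 3 * d + 5 <= #|D|).
Hypothesis bitD : forall u : 'I_nv, bit u = (u \in D).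

Definition agree (accs : seq accd) (u : 'I_nv) : Prop :=
  forall h, hd u = Hu p h -> forall (c : 'I_l) (j : 'I_d) (r : 'I_W), val r = h * d + j ->
    nth acc0 accs c r = col1 (st u c) j.

Lemma nth_copys h s accs c : size s = l -> size accs = l -> c < l ->
  nth acc0 (copys h s accs) c = acc_upd h (enum_val (nth (od 0) s c)) (nth acc0 accs c).
Proof.
move=> E1 E2 ltc; rewrite (nth_map (od 0, acc0)) ?size_zip ?E1 ?E2 ?minnn //.
by rewrite nth_zip // E1.
Qed.

(** Induction on the number of vertices processed. A member of type [Hu h] rewrites only cell [h],
    and earlier members of that cell carry the same string by [upper_cell_inj], so agreement with
    them survives. *)
Lemma decode_prefix k : k <= nv ->
  let x := foldl (fun x v => vstep l bit v.1 v.2 x) (nseq l acc0, 0) (take k vs) in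
  [/\ x.2 = k, size x.1 = l & forall u : 'I_nv, u < k -> u \in D -> agree x.1 u].
Proof.
elim: k => [|k IH] ltk; first by rewrite take0 /= size_nseq.
have [E2 Es Ha] := IH (ltnW ltk).
rewrite (take_nth (0, Hz)) ?size_vs // foldl_rcons.
set x := foldl _ _ _ in E2 Es Ha *.
rewrite /= E2; pose v := Ordinal ltk.
rewrite -[nth _ _ _]/(lab v) -[bit k]/(bit v) bitD.
case vD: (v \in D); last first.
  split=> // u; rewrite ltnS leq_eqVlt => /orP[/eqP Eu|ltu] uD0; last exact: Ha.
  by move: vD; have <- : u = v by [apply: val_inj]; rewrite uD0.
have dgE := size_digs b_gt0 l (lab v).1.
case Ev: (lab v).2 => [||g|g|h|h1 h2 h3]; split=> //.
1-4,7: move=> u; rewrite ltnS leq_eqVlt => /orP[/eqP Eu|ltu] uD0; last exact: Ha.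
1-5: by have -> : u = v by [apply: val_inj]; move=> h'; rewrite /hd Ev.
  by rewrite size_copys // Es.
move=> u ltu uD0 h' Eh' c j r Er; rewrite nth_copys // ffunE.
have ltj := ltn_ord j.
have Ed : r %/ d = h' by rewrite Er divnMDl // divn_small // addn0.
rewrite Ed; case: eqP => [/val_inj Eh|ne].
  rewrite -Eh in Ev *.
  have Ej : row_of d_gt0 r = j by apply: val_inj; rewrite /= Er modnMDl modn_small.
  rewrite Ej.
  by rewrite (upper_cell_inj t_gt0 (ncols_ge N) red_adjE lab_inj lab_surj uD big uD0 vD Eh' Ev c).
move: ltu; rewrite ltnS leq_eqVlt => /orP[/eqP Eu|ltu]; last exact: (Ha u ltu uD0 _ Eh' c j r Er).
case: ne; have E : u = v by apply: val_inj.
by move: Eh'; rewrite E /hd Ev => -[->].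
Qed.

Lemma decode_sat :
  falsified (fun v => Some (acc_val (decode_from l bit (nseq l acc0, 0)).1 v)) phi = false.
Proof.
have Efold : decode_from l bit (nseq l acc0, 0) =
    foldl (fun x v => vstep l bit v.1 v.2 x) (nseq l acc0, 0) vs.
  rewrite /decode_from /vs; elim: (iota _ _) (nseq _ _, 0) => //= i r IH x.
  rewrite foldl_cat IH; congr foldl.
  by elim: (Hs) x {IH} => //=.
have [_ _ Ha] := decode_prefix (leqnn nv).
rewrite take_oversize ?size_vs // -Efold in Ha.
apply: (upper_sat t_gt0 (ncols_ge N) red_adjE lab_inj lab_surj uD big).
move=> u h uD0 Eh c j; rewrite /acc_val.
have ltj : h * d + j < W.
  have := ltn_ord h; have := ltn_ord j; nia.
rewrite divnMDl ?W_gt0 // (divn_small ltj) addn0.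
apply: (Ha u (ltn_ord u) uD0 h Eh c j).
by rewrite /= modnMDl modn_small.
Qed.

End DecodeCorrect.

Lemma not_falsified_sat (a : nat -> bool) :
  falsified (fun v => Some (a v)) phi = false -> satisfiable phi.
Proof.
move=> H; apply/existsP; exists [ffun v : 'I_N => a v]; apply/allP => c cphi.
apply: contraFT H => /hasPn Hc; apply/hasP; exists c => //; apply/allP => x xc.
by have := Hc x xc; rewrite ffunE; case: (a _) (x.2) => [] [].
Qed.

Lemma run_halting y k k' : halts_within M y k -> halts_within M y k' ->
  run M y k = run M y k'.
Proof.
wlog le : k k' / k <= k'.
  move=> H Hk Hk'; case: (leqP k k') => [|/ltnW] le; first exact: H.
  by apply/esym/H.
by move=> Hk _; rewrite /run -(subnK le) iterD (iter_step_halting _ Hk).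
Qed.

Definition sat_machine K := compile (mainp K) (rg (start M) false).

(** The quality of the answer matters for satisfiable formulas only: acceptance is always justified,
    because the decoded assignment has been checked against the formula. *)
Lemma sat_machine_spec K k :
  halts_within M (encode_instance red_graph K) k ->
  (satisfiable phi -> exists D : {set 'I_nv},
     [/\ outputs M (encode_instance red_graph K) (encode_set D),
         upper_dominating red_graph D & 3 * t + 3 * d + 5 <= #|D|]) ->
  outputs (sat_machine K) (encode_formula phi) [:: satisfiable phi] /\
  halts_within (sat_machine K) (encode_formula phi) (main_cost phi K k).
Proof.
rewrite encode_red => Hk HD.
have [f [tp [bit [H Hbit Etp]]]] := exec_main Hk.
have [Ho Hh] := compile_outputs H Etp erefl; split=> //.
suff <- : ~~ falsified (fun v => Some (acc_val
      (decode_from (ncols N) bit (nseq (ncols N) acc0, 0)).1 v)) phi = satisfiable phi by [].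
apply/negPf/idP => [/not_falsified_sat //|sat].
have [D [[k' Hk' Ey] uD big]] := HD sat.
apply: (decode_sat uD big) => u.
have Er : result (run M (instance_word phi K) k) = encode_set D.
  by rewrite (run_halting Hk Hk') Ey.
rewrite Er size_map size_enum_ord in Hbit; rewrite (Hbit u (ltn_ord u)).
by rewrite (nth_map u) ?size_enum_ord // nth_ord_enum.
Qed.

End Correct.

End Construction.

(** * Running time *)

(** Distinctness leaves at most [(N * 2) ^ 3] clauses, each encoded with at most [3 * N.+1 + 1]
    bits. *)
Lemma size_encode_formula N (phi : formula N) : uniq phi ->
  size (encode_formula phi) <= 40 * N.+1 ^ 4.
Proof.
move=> uphi.
have szl (q : literal N) : size (encode_literal q) <= N.+1.
  by rewrite /= size_rcons size_nseq; case: q => v s /=; have := ltn_ord v.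
have szc (c : clause N) : size (true :: encode_clause c) <= (3 * N.+1).+1.
  case: c => -[|q1 [|q2 [|q3 [|]]]] // c3.
  have -> : encode_clause (Tuple c3) = encode_literal q1 ++ encode_literal q2 ++ encode_literal q3.
    by rewrite /encode_clause /= cats0.
  rewrite -cat1s !size_cat.
  by move: (szl q1) (szl q2) (szl q3); move: (size _) (size _) (size _) => i1 i2 i3 /=; lia.
have szf (s : formula N) : size (flatten [seq true :: encode_clause c | c <- s]) <= size s * (3 * N.+1).+1.
  by elim: s => //= c s IH; rewrite size_cat; have := szc c => /=; rewrite mulSn; lia.
have szphi : size phi <= (N * 2) ^ 3.
  have -> : (N * 2) ^ 3 = #|{: clause N}|.
    by rewrite card_tuple card_prod card_ord card_bool.
  by rewrite -(card_uniqP uphi) max_card.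
rewrite /encode_formula !size_cat size_rcons size_nseq /=.
have H1 := szf phi.
have H2 : size phi * (3 * N.+1).+1 <= (N * 2) ^ 3 * (3 * N.+1).+1 by rewrite leq_mul2r szphi orbT.
have H3 : (N * 2) ^ 3 * (3 * N.+1).+1 <= 8 * N.+1 ^ 3 * (4 * N.+1).
  apply: leq_mul; last by lia.
  have -> : (N * 2) ^ 3 = 8 * N ^ 3 by ring.
  by rewrite leq_mul2l leq_exp2r // leqnSn.
have H4 : 8 * N.+1 ^ 3 * (4 * N.+1) = 32 * N.+1 ^ 4 by ring.
have H5 : N.+1 <= N.+1 ^ 4 by rewrite -[leqLHS]expn1 leq_pexp2l.
lia.
Qed.

Section Cost.
Variables (p d t : nat) (d_gt0 : 0 < d) (t_gt0 : 0 < t).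
Variables (N : nat) (phi : formula N) (K k : nat).
Local Notation b := #|{: digit p d t}|.
Local Notation l := (ncols d t N).
Local Notation h := (nH p t).
Local Notation E := (size (encode_formula phi)).

Lemma nH_gt0 : 0 < h.
Proof. by rewrite /nH -cardE; apply/card_gt0P; exists Hz. Qed.

Lemma ncols_leS : l <= N.+1.
Proof.
have := ncols_le d_gt0 t_gt0 N; have := W_gt0 d_gt0 t_gt0.
by move: l (t * d) => i j; nia.
Qed.

Lemma size_instance_word :
  size (instance_word p t d_gt0 phi K) = (b ^ l * h).+1 + (K.+1 + (b ^ l * h) ^ 2).
Proof.
rewrite -encode_red /encode_instance !size_cat !size_rcons !size_nseq size_allpairs.
by rewrite size_enum_ord -mulnn.
Qed.

(** The main term is the adjacency matrix, with [(b ^ l * h) ^ 2] entries at a cost quadratic in the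
    input length each. [K] enters through writing the parameter and rewinding over it, and [2 * k]
    through the simulation. *)
Lemma main_cost_le :
  main_cost p t d_gt0 phi K k <= (600 + 4 * K) * (b ^ l * h * E) ^ 2 + 2 * k.
Proof.
rewrite /main_cost size_instance_word /gen_cost /count_cost /matrix_cost /row_cost /decode_cost.
have l_le := ncols_leS; have h0 := nH_gt0.
have E_ge : N.+2 <= E.
  by rewrite /encode_formula !size_cat size_rcons size_nseq /= addnA; lia.
have B0 : 0 < b ^ l by rewrite expn_gt0 b_gt0.
move: (b ^ l) B0 => B B0; move: E l h l_le h0 E_ge => e n m l_le h0 E_ge.
have ne : n <= e by lia.
have e0 : 0 < e by lia.
have [X EX] : exists X, X = B * m * e by exists (B * m * e).
rewrite -EX.
have X0 : 0 < X by rewrite EX !muln_gt0 B0 h0.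
have eX : e <= X by rewrite EX leq_pmull // muln_gt0 B0 h0.
have BmX : B * m <= X by rewrite EX leq_pmulr.
have adj : e * (2 * n + 25) + 10 + 8 * n + 20 <= 65 * (e * e) by nia.
move: (e * (2 * n + 25) + 10 + 8 * n + 20) adj => a adj.
have row : B * ((m * a).+1 + 4 * n + 11) + 2 <= 83 * (B * m * (e * e)).
  have h1 : (m * a).+1 + 4 * n + 11 <= 81 * (m * (e * e)).
    have : m * a <= m * (65 * (e * e)) by rewrite leq_mul2l adj orbT.
    have : e * e <= m * (e * e) by rewrite leq_pmull.
    have : e <= e * e by rewrite leq_pmull.
    lia.
  have : B * ((m * a).+1 + 4 * n + 11) <= B * (81 * (m * (e * e))) by rewrite leq_mul2l h1 orbT.
  have : 0 < B * m * (e * e) by rewrite !muln_gt0 B0 h0 e0.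
  lia.
move: (B * ((m * a).+1 + 4 * n + 11) + 2) row => r row.
have mat : B * ((m * r).+1 + 4 * n + 11) + 2 <= 101 * X ^ 2.
  have h1 : (m * r).+1 + 4 * n + 11 <= 99 * (m * (B * m * (e * e))).
    have : m * r <= m * (83 * (B * m * (e * e))) by rewrite leq_mul2l row orbT.
    have : e <= m * (B * m * (e * e)).
      have -> : m * (B * m * (e * e)) = (m * B * m * e) * e by ring.
      by rewrite leq_pmull // !muln_gt0 h0 B0 e0.
    lia.
  have : B * ((m * r).+1 + 4 * n + 11) <= B * (99 * (m * (B * m * (e * e)))) by rewrite leq_mul2l h1 orbT.
  have : X ^ 2 = B * (m * (B * m * (e * e))) by rewrite EX; ring.
  have : 0 < X ^ 2 by rewrite expn_gt0 X0.
  lia.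
have cnt : B * ((m * 1).+1 + 4 * n + 11) + 2 <= 19 * X ^ 2.
  have : B * ((m * 1).+1 + 4 * n + 11) <= B * (17 * (m * e)).
    by rewrite leq_mul2l; apply/orP; right; nia.
  have : X <= X ^ 2 by rewrite -mulnn leq_pmull.
  have : B * (17 * (m * e)) = 17 * X by rewrite EX; ring.
  lia.
have dec : B * ((m * (7 * n + 13)).+1 + 4 * n + 11) + 2 <= 38 * X ^ 2.
  have : B * ((m * (7 * n + 13)).+1 + 4 * n + 11) <= B * (36 * (m * e)).
    by rewrite leq_mul2l; apply/orP; right; nia.
  have : X <= X ^ 2 by rewrite -mulnn leq_pmull.
  have : B * (36 * (m * e)) = 36 * X by rewrite EX; ring.
  lia.
have fin : e * (2 * n + 27) + 20 <= 49 * X ^ 2.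
  have h1 : e * (2 * n + 27) <= e * (29 * e) by rewrite leq_mul2l; apply/orP; right; lia.
  have : e * e <= X * X by apply: leq_mul.
  have : 0 < X ^ 2 by rewrite expn_gt0 X0.
  rewrite -mulnn; lia.
have BmX2 : (B * m) ^ 2 <= X ^ 2 by rewrite leq_exp2r.
have X1 : X <= X ^ 2 by rewrite -mulnn leq_pmull.
have KX : K <= K * X ^ 2 by rewrite leq_pmulr // expn_gt0 X0.
move: (X ^ 2) mat cnt dec fin BmX2 X1 KX => Y mat cnt dec fin BmX2 X1 KX.
have -> : (600 + 4 * K) * Y = 600 * Y + 4 * (K * Y) by ring.
lia.
Qed.
End Cost.

Local Open Scope ring_scope.

(** * Choice of the prime and of the number of rows per cell *)

Section Constants.
Variable R : realType.

(** One term of the exponential series at [g * N.+1] already dominates the power; passing from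
    [N.+1] to [N] costs the factor [expR g]. *)
Lemma poly_le_expR (g : R) (a : nat) : 0 < g ->
  exists2 C : R, 0 < C & forall N : nat, N.+1%:R ^+ a.+1 <= C * expR (g * N%:R).
Proof.
move=> g0; exists ((a.+1)`!%:R * g^-1 ^+ a.+1 * expR g).
  by rewrite !mulr_gt0 ?expR_gt0 ?exprn_gt0 ?invr_gt0 // ltr0n fact_gt0.
move=> N; have f0 : 0 < (a.+1)`!%:R :> R by rewrite ltr0n fact_gt0.
have := @expR_ge1Dxn R (g * N.+1%:R) a (mulr_ge0 (ltW g0) (ler0n _ _)).
move=> /(le_trans _) H.
have {H} : (g * N.+1%:R) ^+ a.+1 / (a.+1)`!%:R <= expR (g * N.+1%:R).
  by apply: H; rewrite lerDr.
rewrite ler_pdivrMr // exprMn -ler_pdivlMl ?exprn_gt0 // => /le_trans; apply.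
rewrite exprVn -natr1 mulrDr mulr1 expRD.
by rewrite le_eqVlt; apply/orP; left; apply/eqP; ring.
Qed.

(** The number of strings will be exponential in [N] with rate [(3 + ln p) / d]. The bound with
    factor 4 controls the square of this number, the last bound the running time of the
    approximation. Both follow from [d] being proportional to [p] and the logarithm being at most
    [p ^ s / s]: with [s] half of [e], a negative power of [p] remains. *)
Lemma choose_parameters (rho del eps : R) (N0 : nat) :
  0 < rho -> rho <= 1 -> 0 < del -> 0 < eps -> exists p d : nat,
  [/\ prime p, (0 < d)%N, (N0 <= p)%N & (6 * d + 5)%:R <= rho * p%:R] /\
  (3 + ln p%:R) / d%:R * 4 <= del /\ (3 + ln p%:R) / d%:R * p%:R `^ (1 - eps) <= del.
Proof.
move=> rho0 rho1 del0 eps0; pose e := Num.min eps 1; pose s := e / 2.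
have e0 : 0 < e by rewrite lt_min eps0 ltr01.
have e1 : e <= 1 by rewrite ge_min lexx orbT.
have ee : e <= eps by rewrite ge_min lexx.
have s0 : 0 < s by rewrite divr_gt0.
(* 96 is the product of 24, from the lower bound [rho * p / 24] on [d], and the factor 4 of the
   claim. *)
pose c := 96 * (3 + s^-1) / rho.
have c0 : 0 < c by rewrite divr_gt0 ?mulr_gt0 ?addr_gt0 ?invr_gt0.
pose y := (c / del) `^ s^-1.
have y0 : 0 <= y by apply: powR_ge0.
have z0 : 0 <= 24 / rho by rewrite divr_ge0 // ltW.
have [p ltp p_pr] := prime_above (N0 + Num.bound (24 / rho) + Num.bound y).
have Hz : 24 / rho <= p%:R.
  apply: le_trans (ltW (archi_boundP z0)) _; rewrite ler_nat.
  by apply: leq_trans (ltnW ltp); rewrite -addnA addnCA leq_addr.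
have Hy : y <= p%:R.
  apply: le_trans (ltW (archi_boundP y0)) _; rewrite ler_nat.
  by apply: leq_trans (ltnW ltp); rewrite leq_addl.
have p1 : 1 <= p%:R :> R by rewrite ler1n prime_gt0.
have p0 : 0 < p%:R :> R by rewrite ltr0n prime_gt0.
have rp : 24 <= rho * p%:R by rewrite mulrC -ler_pdivrMr.
(* As [rho * p] is at least 24, rounding down keeps at least half of [x], and [6 * d + 5] is at most
   [rho * p / 2 + 5], hence at most [rho * p]. *)
pose x := rho * p%:R / 12.
have x0 : 0 <= x by rewrite divr_ge0 // mulr_ge0 // ltW.
have /andP[d1 d2] := truncn_itv x0.
exists p, (Num.truncn x); set d := Num.truncn x in d1 d2 *.
have d3 : rho * p%:R / 24 <= d%:R.
  by move: d2; rewrite -natr1 /x; lra.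
have d4 : (1 : R) <= d%:R by lra.
have d0 : 0 < d%:R :> R by lra.
have ps : c / del <= p%:R `^ s.
  have -> : c / del = y `^ s.
    by rewrite /y -powRrM mulVf ?gt_eqF // powRr1 // divr_ge0 // ltW.
  by apply: ge0_ler_powR; rewrite ?nnegrE // ltW.
have ps1 : 1 <= p%:R `^ s.
  by rewrite -[leLHS](powRr0 p%:R); apply: ler_powR => //; apply: ltW.
have lnp : ln p%:R <= s^-1 * p%:R `^ s.
  have := ln_sublinear (powR_gt0 s p0); rewrite ln_powR => /ltW.
  by rewrite -ler_pdivlMl.
have kap : 3 + ln p%:R <= (3 + s^-1) * p%:R `^ s.
  by rewrite mulrDl lerD // ler_peMr.
have kap0 : (0 : R) <= 3 + ln p%:R by rewrite addr_ge0 // ln_ge0.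
have P1 : 1 <= p%:R `^ (1 - e).
  by rewrite -[leLHS](powRr0 p%:R); apply: ler_powR => //; lra.
have key : (3 + ln p%:R) / d%:R * 4 * p%:R `^ (1 - e) <= del.
  have h1 : (3 + ln p%:R) / d%:R <= (3 + s^-1) * p%:R `^ s / (rho * p%:R / 24).
    apply: ler_pM => //; first by rewrite invr_ge0 ltW.
    by rewrite lef_pV2 ?posrE // divr_gt0 // mulr_gt0.
  have h2 : (3 + s^-1) * p%:R `^ s / (rho * p%:R / 24) * 4 * p%:R `^ (1 - e) = c / p%:R `^ s.
    have E1 : p%:R `^ (1 - e) = p%:R / (p%:R `^ s * p%:R `^ s).
      have -> : 1 - e = 1 - (s + s) by rewrite /s; lra.
      rewrite powRB ?(gt_eqF p0) ?implybT // powRr1 ?(ltW p0) //.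
      by rewrite powRD // (gt_eqF p0) implybT.
    rewrite E1 /c; field.
    by rewrite !gt_eqF // powR_gt0.
  have h3 : c / p%:R `^ s <= del.
    by rewrite ler_pdivrMr ?powR_gt0 // mulrC -ler_pdivrMr.
  apply: le_trans h3; rewrite -h2 ler_pM2r ?ler_pM2r //; lra.
have kd : (0 : R) <= (3 + ln p%:R) / d%:R by rewrite divr_ge0 // ltW.
split; [split=> // | split].
- by rewrite -(ltr0n R).
- by apply: leq_trans (ltnW ltp); rewrite -addnA leq_addr.
- by rewrite natrD natrM; move: d1; rewrite /x; lra.
- apply: le_trans key; rewrite ler_peMr // mulr_ge0 //.
- apply: le_trans key; apply: ler_pM => //; first exact: powR_ge0.
    by rewrite ler_peMr // ler1n.
  by apply: ler_powR => //; lra.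
Qed.

End Constants.


(** * The number of vertices of the reduction graph *)

Section Growth.
Variables (R : realType) (p d : nat).
Hypotheses (p_pr : prime p) (d_gt0 : (0 < d)%N).
Local Notation kappa := (3 + ln p%:R : R).
Local Notation b := #|{: digit p d d}|.

Lemma leq_prime_nH t : (p <= nH p t)%N.
Proof.
rewrite /nH -cardE -{1}(card_Fp p_pr); apply: (@leq_card _ _ (@Hb p t)).
by move=> g g' [].
Qed.

Lemma kappa_ge0 : 0 <= kappa.
Proof. by rewrite addr_ge0 // ln_ge0 // ler1n prime_gt0. Qed.

(** For [t = d] there are [2 ^ (3 * d) * p ^ d] digits, and 2 is at most the base of the natural
    exponential. *)
Lemma card_digit_le : b%:R <= expR (d%:R * kappa).
Proof.
have -> : b = (2 ^ (3 * d) * p ^ d)%N.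
  rewrite !card_prod !card_ffun (card_Fp p_pr) card_bool !card_ord.
  by rewrite -!expnD; congr (2 ^ _ * _)%N; lia.
rewrite natrM !natrX mulrDr expRD; apply: ler_pM; rewrite ?exprn_ge0 //.
  have -> : d%:R * 3 = (3 * d)%:R * 1 :> R by rewrite natrM; ring.
  rewrite expRM_natl.
  by rewrite lerXn2r ?nnegrE ?expR_ge0 // (le_trans _ (expR_ge1Dx 1)) //; lra.
by rewrite expRM_natl lnK // posrE ltr0n prime_gt0.
Qed.

(** For [t = d] a column holds [d * d] variables, so there are at most [N / d ^ 2 + 1] columns, and
    each contributes [d * kappa] to the exponent. *)
Lemma card_strings_le N :
  (b ^ ncols d d N)%:R <= expR (d%:R * kappa + kappa / d%:R * N%:R).
Proof.
have d0 : 0 < d%:R :> R by rewrite ltr0n.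
rewrite natrX; apply: (@le_trans _ _ (expR (d%:R * kappa) ^+ ncols d d N)).
  by rewrite lerXn2r ?nnegrE ?expR_ge0 ?ler0n ?card_digit_le.
rewrite -expRM_natl ler_expR.
have := ncols_le d_gt0 d_gt0 N; rewrite -(ler_nat R) natrD !natrM => H.
have {}H : (ncols d d N)%:R * d%:R <= N%:R / d%:R + d%:R :> R.
  rewrite -(ler_pM2r d0) mulrDl divfK ?gt_eqF //; lra.
have := ler_wpM2r kappa_ge0 H.
have -> : (N%:R / d%:R + d%:R) * kappa = d%:R * kappa + kappa / d%:R * N%:R by ring.
by have -> : (ncols d d N)%:R * d%:R * kappa = (ncols d d N)%:R * (d%:R * kappa) by ring.
Qed.

End Growth.

Theorem theorem2 (R : realType) (hETH : ETH R) (r eps : R)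
    (hr : 0 < r) (heps : 0 < eps) :
  ~ exists M : machine, uds_approximation r M /\ uds_time M eps.
Proof.
case: hETH => delta delta0 noM [M [approx [C [N0 time]]]]; apply: noM.
pose rho := Num.min r r^-1.
have rho0 : 0 < rho by rewrite lt_min hr invr_gt0 hr.
have rho1 : rho <= 1.
  rewrite ge_min; case: (lerP r 1) => //= r1.
  by rewrite invf_le1 // ltW.
pose del := delta * ln 2.
have del0 : 0 < del by rewrite mulr_gt0 // ln_gt0 // ltr1n.
have [p [d [[p_pr d_gt0 N0p big] [H4 Hx]]]] := choose_parameters N0 rho0 rho1 del0 heps.
set kappa := 3 + ln p%:R in H4 Hx.
have kap0 : 0 <= kappa := kappa_ge0 R p_pr.
pose h := nH p d.
have hp : (p <= h)%N := leq_prime_nH p_pr d.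
(* The parameter is [p]. It is at least [N0], and the graph has at least [h >= p] vertices, so the
   time bound applies even for small [N]. *)
have run_time N (phi : formula N) : exists2 k : nat,
    halts_within M (encode_instance (red_graph p d d_gt0 phi) p) k &
    k%:R <= C * (nv p d d N)%:R `^ (p%:R `^ (1 - eps)).
  apply: time => //; apply: leq_trans N0p _; apply: leq_trans hp _.
  by rewrite /nv leq_pmull // expn_gt0 b_gt0.
have spec N (phi : formula N) k :
    halts_within M (encode_instance (red_graph p d d_gt0 phi) p) k ->
    outputs (sat_machine M p d_gt0 d_gt0 p) (encode_formula phi) [:: satisfiable phi] /\
    halts_within (sat_machine M p d_gt0 d_gt0 p) (encode_formula phi)
      (main_cost p d d_gt0 phi p k).
  move=> Hk; apply: (sat_machine_spec d_gt0 Hk) => sat.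
  have [_ []] := approx _ (red_graph p d d_gt0 phi) p.
    apply: (sat_upper d_gt0 (ncols_ge d_gt0 d_gt0 N) (@red_adjE p d d d_gt0 N phi) _ _ p_pr sat).
      exact: lab_inj.
    exact: lab_surj.
  (* With [t = d] the threshold [3 * t + 3 * d + 5] is [6 * d + 5], which was chosen to be at most
     [rho * p]. *)
  move=> D [Ho uD geD]; exists D; split=> //.
  rewrite -(ler_nat R); apply: le_trans geD; apply: le_trans big.
  by rewrite ler_nat; lia.
exists (sat_machine M p d_gt0 d_gt0 p); split.
  by move=> N phi _; have [k Hk _] := run_time N phi; have [] := spec N phi k Hk.
(* The squared input length is at most [1600 * N.+1 ^ 8]. Half of [del] pays for this power, the
   other half for the square of the number of strings. *)
have [Cp Cp0 HCp] := @poly_le_expR R (del / 2) 7 (divr_gt0 del0 (ltr0n _ 2)).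
pose x := p%:R `^ (1 - eps).
have x0 : 0 <= x by apply: powR_ge0.
(* [c1] belongs to the generation of the graph, the decoding and the evaluation, [c2] to the
   simulation of [M]. *)
pose c1 : R := (600 + 4 * p)%:R * (expR (2 * (d%:R * kappa)) * h%:R ^+ 2 * 1600 * Cp).
pose c2 : R := 2 * (`|C| * expR ((h%:R + d%:R * kappa) * x)).
exists (c1 + c2) => N phi uphi.
have [k Hk kle] := run_time N phi; have [_ Hh] := spec N phi k Hk.
exists (main_cost p d d_gt0 phi p k) => //.
have -> : 2 `^ (delta * N%:R) = expR (del * N%:R).
  by rewrite /powR pnatr_eq0 /= /del mulrAC.
apply: (@le_trans _ _ ((600 + 4 * p) * (#|{: digit p d d}| ^ ncols d d N * h * size (encode_formula phi)) ^ 2 + 2 * k)%N%:R).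
  by rewrite ler_nat main_cost_le.
have HB := card_strings_le R p_pr d_gt0 N; rewrite -/kappa in HB.
set B := (#|_| ^ _)%N in HB *; set u := _ + _ in HB.
have HE : (size (encode_formula phi))%:R <= 40 * N.+1%:R ^+ 4 :> R.
  by rewrite -natrX -natrM ler_nat size_encode_formula.
rewrite natrD mulrDl; apply: lerD.
  rewrite natrM /c1 -mulrA; apply: ler_wpM2l; first exact: ler0n.
  have le2 : (B * h * size (encode_formula phi))%:R ^+ 2 <=
      (expR u * h%:R * (40 * N.+1%:R ^+ 4)) ^+ 2.
    rewrite lerXn2r ?nnegrE ?ler0n //.
      by rewrite !mulr_ge0 ?expR_ge0 ?exprn_ge0 ?ler0n.
    by rewrite !natrM; apply: ler_pM => //; rewrite ?mulr_ge0 // ler_wpM2r.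
  rewrite natrX; apply: le_trans le2 _.
  have -> : (expR u * h%:R * (40 * N.+1%:R ^+ 4)) ^+ 2 =
     expR u ^+ 2 * (h%:R ^+ 2 * 1600) * N.+1%:R ^+ 8 by ring.
  have E2 : expR u ^+ 2 = expR (2 * (d%:R * kappa)) * expR (2 * (kappa / d%:R) * N%:R).
    by rewrite -expRM_natl -expRD; congr expR; rewrite /u; ring.
  rewrite E2.
  have le3 := HCp N.
  have le4 : expR (2 * (kappa / d%:R) * N%:R) * expR (del / 2 * N%:R) <= expR (del * N%:R).
    rewrite -expRD ler_expR -mulrDl ler_wpM2r //; lra.
  have p1 : 0 <= expR (2 * (d%:R * kappa)) * (h%:R ^+ 2 * 1600) :> R.
    by rewrite !mulr_ge0 ?expR_ge0 ?exprn_ge0.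
  have le5 := ler_wpM2l (expR_ge0 (2 * (kappa / d%:R) * N%:R)) le3.
  have le6 : expR (2 * (kappa / d%:R) * N%:R) * (Cp * expR (del / 2 * N%:R)) <= Cp * expR (del * N%:R).
    by rewrite mulrCA ler_wpM2l // ltW.
  have := ler_wpM2l p1 (le_trans le5 le6).
  by congr (_ <= _); ring.
rewrite natrM /c2 -mulrA; apply: ler_wpM2l => //.
(* The factor [h] is absorbed as [expR h], which turns the number of vertices into a single
   exponential. *)
have le7 : (nv p d d N)%:R <= expR (h%:R + u).
  rewrite /nv natrM mulrC expRD; apply: ler_pM => //.
  by apply: le_trans (expR_ge1Dx _); rewrite lerDr.
have le8 : (nv p d d N)%:R `^ x <= expR ((h%:R + u) * x).
  by rewrite expRM; apply: ge0_ler_powR; rewrite ?nnegrE ?expR_ge0.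
apply: le_trans kle _.
apply: (@le_trans _ _ (`|C| * (nv p d d N)%:R `^ x)).
  by rewrite ler_wpM2r ?powR_ge0 // ler_norm.
rewrite -mulrA; apply: ler_wpM2l => //; apply: le_trans le8 _.
(* After the constant part is cancelled, the coefficient of [N] is [kappa / d * x], at most [del] by
   [Hx]. *)
rewrite -expRD ler_expR /u addrA mulrDl lerD2l -mulrA [N%:R * x]mulrC mulrA ler_wpM2r //.
Qed.
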